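(* Let $\bar x\in K\cap P$ be a locally optimal solution of the problem of minimizing $f(x)$ over $x\in K\cap P$ (local with respect to the norm of $L^p(\mu)$). Assume that there exists a Slater point, i.e. a point $\hat x\in L^p(\mu)$ with $x_a<\hat x<x_b$ $\mu$-a.e. on $\Omega$, $\langle g_i,\hat x\rangle\le a_i$ for all $i=1,\dots,n$ and $\langle h_j,\hat x\rangle=b_j$ for all $j=1,\dots,m$. Let $\mathcal A(\bar x)=\{i\in\{1,\dots,n\}:\langle g_i,\bar x\rangle=a_i\}$. Then there exist $\zeta\in L^{p'}(\mu)$, $\alpha_i\ge0$ for $i\in\mathcal A(\bar x)$, and $\beta_j\in\mathbb R$ for $j=1,\dots,m$ such that $$f'(\bar x)+\zeta+\sum_{i\in\mathcal A(\bar x)}\alpha_i g_i+\sum_{j=1}^m\beta_j h_j=0,$$ $$\zeta\le0\ \ \mu\text{-a.e. on }\{x_a=\bar x<x_b\},\qquad \zeta=0\ \ \mu\text{-a.e. on }\{x_a<\bar x<x_b\},\qquad \zeta\ge0\ \ \mu\text{-a.e. on }\{x_a<\bar x=x_b\}.$$ Moreover, $\zeta$ can be split as $\zeta=\zeta_b-\zeta_a$ with $\zeta_b=\max(\zeta,0)$, $\zeta_a=\max(-\zeta,0)$, and $\mu$-a.e. it holds that $\zeta_a,\zeta_b\ge0$ on $\Omega$, $\zeta_a=0$ on $\{x_a<\bar x\}$, and $\zeta_b=0$ on $\{\bar x<x_b\}$.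
   Context: Let $(\Omega,\Sigma,\mu)$ be a $\sigma$-finite measure space, $p\in[1,\infty]$ and $p'\in[1,\infty]$ the conjugate exponent, $1/p+1/p'=1$ (with $1/\infty=0$). All function spaces are real, and $\langle y,x\rangle=\int_\Omega yx\,d\mu$ for $y\in L^{p'}(\mu)$, $x\in L^p(\mu)$. For $p<\infty$ one identifies $L^p(\mu)^*=L^{p'}(\mu)$. Let $x_a,x_b:\Omega\to[-\infty,\infty]$ be measurable, let $n,m$ be nonnegative integers, and let $g_1,\dots,g_n,h_1,\dots,h_m\in L^{p'}(\mu)$, $a_i,b_j\in\mathbb R$. Put $$K=\{x\in L^p(\mu): x_a\le x\le x_b\ \mu\text{-a.e.}\},\qquad P=\{x\in L^p(\mu): \langle g_i,x\rangle\le a_i\ (1\le i\le n),\ \langle h_j,x\rangle=b_j\ (1\le j\le m)\}.$$ The objective $f:L^p(\mu)\to\mathbb R$ is Fréchet differentiable; in the case $p=\infty$ it is additionally required that $f'(x)\in L^{1}(\mu)$ (viewed as a subspace of $L^\infty(\mu)^*$) for all $x\in K\cap P$. Notation such as $\{x_a=\bar x<x_b\}$ denotes $\{\omega\in\Omega: x_a(\omega)=\bar x(\omega)<x_b(\omega)\}$. *)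

(* Defs.v *)
From HB Require Import structures.
From mathcomp Require Import all_boot all_order all_algebra.
From mathcomp Require Import all_classical all_reals all_analysis.
From mathcomp Require Import measurable_realfun ess_sup_inf.

Set Implicit Arguments.
Unset Strict Implicit.
Unset Printing Implicit Defensive.

Import Order.TTheory GRing.Theory Num.Theory.
Import numFieldNormedType.Exports.

Local Open Scope classical_set_scope.
Local Open Scope quotient_scope.
Local Open Scope ring_scope.

(* The library's [LspaceType mu p1] (a.e.-classes of measurable functions with
   finite Lp-norm) carries no algebraic structure, and its [LfunType mu p1]
   (functions, no quotient) is an lmodType without a norm.  We equip
   [LspaceType mu p1] with the normedModType structure inherited from
   [LfunType mu p1], so that [nbhs], [differentiable] and ['d] apply to it. *)

Section Lspace_LfunType.
Context d (T : measurableType d) (R : realType).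
Variables (mu : {measure set T -> \bar R}) (p : \bar R) (p1 : (1 <= p)%E).

Local Notation LfT := (LfunType mu p1).
Local Notation Lsp := (LspaceType mu p1).
Local Notation Q := {mfun_ mu, T >-> measurableTypeR R}.

Lemma ae_eq_Lnorm (f g : T -> R) :
  measurable_fun setT f -> measurable_fun setT g -> f = g %[ae mu] ->
  ('N[mu]_p[EFin \o f] = 'N[mu]_p[EFin \o g])%E.
Proof.
move=> mf mg fg; rewrite unlock /Lnorm.
case: p p1 => [r _|_|//].
- congr (_ `^ _)%E; apply: ge0_ae_eq_integral => //.
  + apply: (measurableT_comp (measurable_poweR _)).
    by apply: measurableT_comp => //; exact/measurable_EFinP.
  + apply: (measurableT_comp (measurable_poweR _)).
    by apply: measurableT_comp => //; exact/measurable_EFinP.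
  + by move=> x _; exact: poweR_ge0.
  + by move=> x _; exact: poweR_ge0.
  + by apply: filterS fg => x /(_ I) fgx _ /=; rewrite fgx.
- case: ifPn => // _; apply: eq_ess_sup.
  by apply: filterS fg => x /(_ I) fgx /=; rewrite fgx.
Qed.

Lemma repr_pi_ae (f : {mfun T >-> measurableTypeR R}) :
  (repr (\pi_Q f) : T -> R) = f %[ae mu].
Proof.
have : repr (\pi_Q f) = f %[mod Q] by rewrite reprK.
by move=> /eqmodP/asboolP.
Qed.

Section mfun_of.
Variable f : LfT.
Let g : T -> measurableTypeR R := f.
Let mg : measurable_fun setT g.
Proof. exact: measurable_funPT f. Qed.
HB.instance Definition _ := isMeasurableFun.Build _ _ T (measurableTypeR R) g mg.
Definition mfun_of : {mfun T >-> measurableTypeR R} := g.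
End mfun_of.

Lemma Lspace_of_finite (f : LfT) :
  finite_norm mu p (\pi_Q (mfun_of f) : Q).
Proof.
rewrite /finite_norm (ae_eq_Lnorm _ _ (repr_pi_ae (mfun_of f))).
- exact: Lfunction_finite.
- exact: (measurable_funPT (repr (\pi_Q (mfun_of f)))).
- exact: (measurable_funPT f).
Qed.

Definition Lspace_of (f : LfT) : Lsp :=
  LebesgueSpace.Pack (LebesgueSpace.Class (isFinLebesgue.Build d T R mu p p1
    (\pi_Q (mfun_of f) : Q) (Lspace_of_finite f))).

Lemma Lspace_ofE (f : LfT) : (Lspace_of f : T -> R) = f %[ae mu].
Proof. exact: repr_pi_ae. Qed.

Lemma Lspace_measurable (x : Lsp) : measurable_fun setT (x : T -> R).
Proof. exact: (measurable_funPT (repr (LebesgueSpace.sort x))). Qed.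

Lemma Lspace_Lfun (x : Lsp) : (x : T -> R) \in @Lfun _ T R mu p.
Proof.
apply/andP; split; rewrite inE; first exact: Lspace_measurable.
exact: Lebesgue_finite.
Qed.

Definition Lspace_repr (x : Lsp) : LfT := Lfun_Sub p1 (Lspace_Lfun x).

Lemma Lspace_eqP (x y : Lsp) :
  x = y <-> (x : T -> R) = (y : T -> R) %[ae mu].
Proof.
split=> [->|xy]; first exact: nearW.
have {}xy : LebesgueSpace.sort x = LebesgueSpace.sort y.
  rewrite -[LHS]reprK -[RHS]reprK; apply/eqmodP; exact/asboolP.
case: x y xy => [x [[hx]]] [y [[hy]]] /= xy.
by subst y; rewrite (Prop_irrelevance hx hy).
Qed.

End Lspace_LfunType.

Section Lspace_normedModType.
Context d (T : measurableType d) (R : realType).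
Variables (mu : {measure set T -> \bar R}) (p : \bar R) (p1 : (1 <= p)%E).

Local Notation LfT := (LfunType mu p1).
Local Notation Lsp := (LspaceType mu p1).

HB.instance Definition _ := gen_eqMixin Lsp.
HB.instance Definition _ := gen_choiceMixin Lsp.

Definition Lspace_zero : Lsp := Lspace_of 0.
Definition Lspace_opp (x : Lsp) : Lsp := Lspace_of (- Lspace_repr x).
Definition Lspace_add (x y : Lsp) : Lsp :=
  Lspace_of (Lspace_repr x + Lspace_repr y).
Definition Lspace_scale (c : R) (x : Lsp) : Lsp :=
  Lspace_of (c *: Lspace_repr x).

Lemma Lspace_zeroE : \forall w \ae mu, Lspace_zero w = 0.
Proof. by apply: filterS (Lspace_ofE (0 : LfT)) => w /(_ I). Qed.

Lemma Lspace_oppE x : \forall w \ae mu, Lspace_opp x w = - x w.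
Proof. by apply: filterS (Lspace_ofE (- Lspace_repr x)) => w /(_ I). Qed.

Lemma Lspace_addE x y : \forall w \ae mu, Lspace_add x y w = x w + y w.
Proof.
by apply: filterS (Lspace_ofE (Lspace_repr x + Lspace_repr y)) => w /(_ I).
Qed.

Lemma Lspace_scaleE c x : \forall w \ae mu, Lspace_scale c x w = c * x w.
Proof. by apply: filterS (Lspace_ofE (c *: Lspace_repr x)) => w /(_ I). Qed.

Lemma Lspace_addA : associative Lspace_add.
Proof.
move=> x y z; apply/Lspace_eqP.
have H1 := Lspace_addE x (Lspace_add y z); have H2 := Lspace_addE y z.
have H3 := Lspace_addE (Lspace_add x y) z; have H4 := Lspace_addE x y.
apply: filterS2 (filterI H1 H2) (filterI H3 H4) => w [x_yz yz] [xy_z xy] _.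
by rewrite x_yz yz xy_z xy addrA.
Qed.

Lemma Lspace_addC : commutative Lspace_add.
Proof.
move=> x y; apply/Lspace_eqP.
by apply: filterS2 (Lspace_addE x y) (Lspace_addE y x) => w -> -> _; rewrite addrC.
Qed.

Lemma Lspace_add0 : left_id Lspace_zero Lspace_add.
Proof.
move=> x; apply/Lspace_eqP.
apply: filterS2 (Lspace_addE Lspace_zero x) Lspace_zeroE => w -> -> _.
by rewrite add0r.
Qed.

Lemma Lspace_addN : left_inverse Lspace_zero Lspace_opp Lspace_add.
Proof.
move=> x; apply/Lspace_eqP.
apply: filterS3 (Lspace_addE (Lspace_opp x) x) (Lspace_oppE x) Lspace_zeroE.
by move=> w -> -> -> _; rewrite addNr.
Qed.

HB.instance Definition _ := GRing.isZmodule.Build Lsp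
  Lspace_addA Lspace_addC Lspace_add0 Lspace_addN.

Lemma Lspace_scaleA c e x :
  Lspace_scale c (Lspace_scale e x) = Lspace_scale (c * e) x.
Proof.
apply/Lspace_eqP; have := Lspace_scaleE (c * e) x.
apply: filterS3 (Lspace_scaleE c (Lspace_scale e x)) (Lspace_scaleE e x).
by move=> w -> -> -> _; rewrite mulrA.
Qed.

Lemma Lspace_scale1 : left_id 1 Lspace_scale.
Proof.
move=> x; apply/Lspace_eqP.
by apply: filterS (Lspace_scaleE 1 x) => w -> _; rewrite mul1r.
Qed.

Lemma Lspace_scaleDr : right_distributive Lspace_scale +%R.
Proof.
move=> c x y; apply/Lspace_eqP.
have H1 := Lspace_addE (Lspace_scale c x) (Lspace_scale c y).
have H2 := Lspace_scaleE c (Lspace_add x y); have H3 := Lspace_addE x y.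
have H4 := Lspace_scaleE c y; have H5 := Lspace_scaleE c x.
apply: filterS3 H1 (filterI H2 H3) (filterI H4 H5).
move=> w Hs [Hc Hxy] [Hy Hx] _.
by rewrite [LHS]Hc [RHS]Hs Hxy Hx Hy mulrDr.
Qed.

Lemma Lspace_scaleDl x : {morph Lspace_scale^~ x : c e / c + e}.
Proof.
move=> c e; apply/Lspace_eqP.
have H1 := Lspace_addE (Lspace_scale c x) (Lspace_scale e x).
have H2 := Lspace_scaleE (c + e) x.
have H3 := Lspace_scaleE e x; have H4 := Lspace_scaleE c x.
apply: filterS2 (filterI H1 H2) (filterI H3 H4) => w [Hs Hce] [He Hc] _.
by rewrite [RHS]Hs Hce Hc He mulrDl.
Qed.

HB.instance Definition _ := GRing.Zmodule_isLmodule.Build R Lsp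
  Lspace_scaleA Lspace_scale1 Lspace_scaleDr Lspace_scaleDl.

Definition Lspace_norm (x : Lsp) : R := fine ('N[mu]_p[EFin \o x])%E.

Lemma Lspace_norm_of (f : LfT) :
  Lspace_norm (Lspace_of f) = fine ('N[mu]_p[EFin \o f])%E.
Proof.
congr fine; apply: (ae_eq_Lnorm p1) (Lspace_ofE f) => //.
exact: Lspace_measurable.
Qed.

Lemma Lspace_normD (x y : Lsp) :
  Lspace_norm (x + y) <= Lspace_norm x + Lspace_norm y.
Proof.
by rewrite Lspace_norm_of (ler_LnormD (Lspace_repr x) (Lspace_repr y)).
Qed.

Lemma Lspace_normZ (c : R) (x : Lsp) :
  Lspace_norm (c *: x) = `|c| * Lspace_norm x.
Proof.
rewrite Lspace_norm_of; apply: EFin_inj.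
rewrite (finite_norm_fine (c *: Lspace_repr x)) EFinM.
by rewrite (finite_norm_fine (Lspace_repr x)) (LnormZ (Lspace_repr x)).
Qed.

Lemma Lspace_norm_eq0 (x : Lsp) : Lspace_norm x = 0 -> x = 0.
Proof.
move=> /(@fine_Lnormr_eq0 _ _ _ _ _ _ (Lspace_repr x)) x0.
apply/Lspace_eqP; apply: filterS2 x0 Lspace_zeroE => w x0 z0 _.
by rewrite [RHS]z0; exact: x0.
Qed.

HB.instance Definition _ := Lmodule_isNormed.Build R Lsp
  Lspace_normD Lspace_normZ Lspace_norm_eq0.

End Lspace_normedModType.

Section optimization.
Context d (T : measurableType d) (R : realType).
Variables (mu : {measure set T -> \bar R}).
Variables (p q : \bar R) (p1 : (1 <= p)%E) (q1 : (1 <= q)%E).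

(* For conjugate [p] and [q] the integrand is integrable, so the real-valued
   integral (which is 0 for non-integrable functions) is the intended one. *)
Definition Lpair (y : LspaceType mu q1) (x : LspaceType mu p1) : R :=
  \int[mu]_w (y w * x w).

(* Membership of a functional on L^p in L^q, seen as a subspace of (L^p)^* via
   [y |-> Lpair y]. *)
Definition represents (y : LspaceType mu q1) (phi : LspaceType mu p1 -> R) :=
  forall x, phi x = Lpair y x.

Definition box (xa xb : T -> \bar R) : set (LspaceType mu p1) :=
  [set x | \forall w \ae mu, (xa w <= (x w)%:E <= xb w)%E].

Definition strict_box (xa xb : T -> \bar R) : set (LspaceType mu p1) :=
  [set x | \forall w \ae mu, (xa w < (x w)%:E < xb w)%E].

Definition polyhedron (n m : nat) (g : 'I_n -> LspaceType mu q1)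
    (a : 'I_n -> R) (h : 'I_m -> LspaceType mu q1) (b : 'I_m -> R) :
    set (LspaceType mu p1) :=
  [set x | (forall i, Lpair (g i) x <= a i) /\ (forall j, Lpair (h j) x = b j)].

Definition active (n : nat) (g : 'I_n -> LspaceType mu q1) (a : 'I_n -> R)
    (x : LspaceType mu p1) : {set 'I_n} :=
  [set i | Lpair (g i) x == a i]%SET.

End optimization.
Arguments box {d T R mu p p1} xa xb.
Arguments strict_box {d T R mu p p1} xa xb.

(* Main.v *)
Require Import Defs.
From HB Require Import structures.
From mathcomp Require Import all_boot all_order all_algebra.
From mathcomp Require Import all_classical all_reals all_analysis.
From mathcomp Require Import measurable_realfun ess_sup_inf.
From mathcomp Require Import ring lra.

(** The multiplier rule is finite dimensional once the pointwise constraint is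
    put in the right cone, and the work lies in three facts.

    The functional ['d f xbar] is a function in L^q.  For p = +oo this is
    assumed; for finite p it is the Riesz representation [Lspace_riesz].  Pick
    a weight [eta] with 0 < eta <= 1 that is integrable, hence in every L^p
    (it exists by sigma-finiteness).  Then A |-> phi (eta * 1_A) is a finite
    charge dominated by the measure; its Radon-Nikodym density [rho] gives the
    candidate [rho / eta].  Testing phi on truncations of
    sg(rho) * |rho / eta| ^ (q - 1) and using the boundedness of phi shows that
    the candidate lies in L^q, and truncating an arbitrary element of L^p at
    n * eta shows that it represents phi.

    Multipliers exist.  In L^p the set K of functions between the two bounds
    usually has empty interior, and the Slater point xhat satisfies the bounds
    only strictly almost everywhere, so no separation theorem applies to K
    directly.  Moreover the radial cone of K at xbar need not contain
    xhat - xbar in its relative algebraic interior.  It does after shrinking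
    the cone to the directions v for which both xbar + c v and xhat - c v stay
    in K for some c > 0 ([two_point_cone], [two_point_cone_core]).  On a convex
    cone S with such a core point e satisfying the finitely many linear
    constraints, a linear functional that is nonnegative on the constrained
    part of S becomes nonnegative on all of S after adding a combination of the
    constraints ([multiplier_le_eq]).  The inequalities need not be strict at
    e: if one of them can be made strict it is removed by a one-dimensional
    separation, and if none can, all of them are equations on the constrained
    part of S and the signs of their multipliers can be repaired
    ([multiplier_le]).  The hypothesis on the constrained cone holds because a
    local minimum has nonnegative derivative along feasible directions
    ([linearized_optimality]).

    The resulting psi = f'(xbar) + sum alpha_i g_i + sum beta_j h_j is
    nonnegative on the shrunken cone, which is still large enough.  For k in K,
    the function equal to k - xbar where xhat - (k - xbar) / (n + 1) respects
    the bounds and to xhat - xbar elsewhere lies in the cone, and these functions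
    converge to k - xbar with a fixed dominating function, because
    xhat satisfies the bounds strictly almost everywhere
    ([box_variational]).  Hence the integral of psi (k - xbar) is nonnegative
    for every k in K, and localizing to measurable sets gives the pointwise
    signs of psi, so that zeta = - psi is the required multiplier. *)

Set Implicit Arguments.
Unset Strict Implicit.
Unset Printing Implicit Defensive.

Import Order.TTheory GRing.Theory Num.Theory.
Import numFieldNormedType.Exports.

Local Open Scope classical_set_scope.
Local Open Scope ring_scope.

(** * Multipliers on convex cones *)

Section multipliers.
Context (R : realType) (V : lmodType R).
Implicit Types (S K : set V) (phi psi : V -> R).

Definition is_convex_cone S :=
  (forall u v, S u -> S v -> S (u + v)) /\
  (forall (c : R) v, 0 <= c -> S v -> S (c *: v)).

(** On a convex cone, the points of the relative algebraic interior. *)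
Definition core_point S (e : V) :=
  S e /\ forall v, S v -> exists2 eps : R, 0 < eps & S (e - eps *: v).

Lemma scalar0 phi : scalar phi -> phi 0 = 0.
Proof.
by move=> lphi; have := lphi (- 1) 0 0; rewrite scaler0 addr0 mulN1r addNr.
Qed.

Lemma scalarD phi u v : scalar phi -> phi (u + v) = phi u + phi v.
Proof. by move=> lphi; rewrite -{1}[u]scale1r lphi mul1r. Qed.

Lemma scalarZ phi (c : R) v : scalar phi -> phi (c *: v) = c * phi v.
Proof. by move=> lphi; rewrite -[c *: v]addr0 lphi scalar0// addr0. Qed.

Lemma scalar_sum (I : finType) (A : {set I}) (g : I -> V -> R) (c : I -> R) :
  (forall i, scalar (g i)) -> scalar (fun v => \sum_(i in A) c i * g i v).
Proof.
move=> lg k u v; rewrite mulr_sumr -big_split/=; apply: eq_bigr => i _.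
by rewrite lg; ring.
Qed.

Lemma cone_cap S (P : V -> Prop) : is_convex_cone S ->
  (forall u v, P u -> P v -> P (u + v)) ->
  (forall (c : R) v, 0 <= c -> P v -> P (c *: v)) ->
  is_convex_cone (S `&` P).
Proof.
move=> [SD SZ] PD PZ; split=> [u v [Su Pu] [Sv Pv]|c v c0 [Sv Pv]]; split.
- exact: SD.
- exact: PD.
- exact: SZ.
- exact: PZ.
Qed.

Lemma cone_cap_eq S h : is_convex_cone S -> scalar h ->
  is_convex_cone (S `&` [set v | h v = 0]).
Proof.
move=> cS lh; apply: cone_cap => //=.
  by move=> u v hu hv; rewrite scalarD// hu hv addr0.
by move=> c v _ hv; rewrite scalarZ// hv mulr0.
Qed.

Lemma cone_cap_le S g : is_convex_cone S -> scalar g ->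
  is_convex_cone (S `&` [set v | g v <= 0]).
Proof.
move=> cS lg; apply: cone_cap => //=.
  by move=> u v gu gv; rewrite scalarD//; lra.
by move=> c v c0 gv; rewrite scalarZ// mulr_ge0_le0.
Qed.

Lemma core_cap_eq S e h : scalar h -> h e = 0 ->
  core_point S e -> core_point (S `&` [set v | h v = 0]) e.
Proof.
move=> lh he [Se coree]; split=> // v [Sv /= hv].
have [eps eps0 Sev] := coree v Sv; exists eps => //; split=> //=.
by rewrite -scaleNr scalarD// scalarZ// he hv; ring.
Qed.

Lemma core_cap_lt S e g : is_convex_cone S -> scalar g -> g e < 0 ->
  core_point S e -> core_point (S `&` [set v | g v <= 0]) e.
Proof.
move=> [SD SZ] lg ge [Se coree]; split=> [|v [Sv /= gv]]; first by split=> //=; lra.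
have [eps eps0 Sev] := coree v Sv.
(* with this fraction [t] of the step [eps], [g] takes at the new point the
   value [t * g e] *)
pose t := - g e / (- g e + eps * - g v).
have den0 : 0 < - g e + eps * - g v.
  by apply: ltr_pwDl; [lra | apply: mulr_ge0; lra].
have t0 : 0 < t by rewrite divr_gt0//; lra.
have t1 : t <= 1.
  by rewrite ler_pdivrMr// mul1r lerDl mulr_ge0; lra.
exists (t * eps); first exact: mulr_gt0.
split.
  have -> : e - (t * eps) *: v = (1 - t) *: e + t *: (e - eps *: v).
    by rewrite scalerBl scale1r scalerBr scalerA addrA subrK.
  by apply: SD; apply: SZ => //; lra.
rewrite /= -scaleNr scalarD// scalarZ//.
have tden : t * (- g e + eps * - g v) = - g e by rewrite divfK// gt_eqF.
have : t * g e <= 0 by rewrite mulr_ge0_le0// ltW.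
by move: tden; nra.
Qed.

(** The multiplier has to lie between the quotients [- phi w / g w] with
    [0 < g w] and [phi v / - g v] with [g v < 0]; the former never exceed the
    latter because [g w *: v - g v *: w] is a point of the cone on which [g]
    vanishes. *)
Lemma multiplier_two_sided S phi g (u w : V) : is_convex_cone S ->
  scalar phi -> scalar g -> S u -> g u < 0 -> S w -> 0 < g w ->
  (forall v, S v -> g v = 0 -> 0 <= phi v) ->
  exists beta, forall v, S v -> 0 <= phi v + beta * g v.
Proof.
move=> [SD SZ] lphi lg Su gu Sw gw phi0.
have cross v z : S v -> S z -> g v < 0 -> 0 < g z ->
    - phi z / g z <= phi v / - g v.
  move=> Sv Sz gv gz.
  have : 0 <= phi (g z *: v + (- g v) *: z).
    apply: phi0; first by apply: SD; apply: SZ => //; lra.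
    by rewrite scalarD// !scalarZ//; ring.
  rewrite scalarD// !scalarZ// => h.
  by rewrite ler_pdivrMr// mulrAC ler_pdivlMr; [nra|lra].
pose E := [set phi v / - g v | v in S `&` [set v | g v < 0]].
have E0 : E !=set0 by exists (phi u / - g u), u.
have lbE z : S z -> 0 < g z -> lbound E (- phi z / g z).
  by move=> Sz gz _ [v [Sv /= gv] <-]; exact: cross.
have hE : has_inf E by split=> //; exists (- phi w / g w); exact: lbE.
exists (inf E) => v Sv; have [gv|gv|gv] := ltgtP (g v) 0.
- have : inf E <= phi v / - g v by apply: ge_inf; [case: hE|exists v].
  by rewrite ler_pdivlMr; [nra|lra].
- have : - phi v / g v <= inf E by apply: lb_le_inf => //; exact: lbE.
  by rewrite ler_pdivrMr//; nra.
- by rewrite gv mulr0 addr0; exact: phi0.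
Qed.

(** The core point makes [h] take both signs as soon as it is not identically
    zero on the cone, which is what the two-sided case asks for. *)
Lemma multiplier_eq1 S e phi h : is_convex_cone S -> core_point S e ->
  scalar phi -> scalar h -> h e = 0 ->
  (forall v, S v -> h v = 0 -> 0 <= phi v) ->
  exists beta, forall v, S v -> 0 <= phi v + beta * h v.
Proof.
move=> cS [Se coree] lphi lh he phi0.
have [h0|] := pselect (forall v, S v -> h v = 0).
  by exists 0 => v Sv; rewrite mul0r addr0; apply: phi0 => //; exact: h0.
move=> /existsNP[v /not_implyP[Sv /eqP hv]].
have [eps eps0 Sev] := coree v Sv.
have hev : h (e - eps *: v) = - (eps * h v).
  by rewrite -scaleNr scalarD// scalarZ// he; ring.
have [hv0|hv0] := ltP (h v) 0.
  by apply: (@multiplier_two_sided S phi h v (e - eps *: v)) => //; rewrite hev; nra.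
have {}hv0 : 0 < h v by rewrite lt_neqAle eq_sym hv.
by apply: (@multiplier_two_sided S phi h (e - eps *: v) v) => //; rewrite hev; nra.
Qed.

(** If [g] is positive somewhere, the two-sided case gives a multiplier of
    unknown sign; a negative one can be replaced by zero, since [phi] is
    nonnegative where [g] is not positive. *)
Lemma multiplier_le1 S u phi g : is_convex_cone S ->
  scalar phi -> scalar g -> S u -> g u < 0 ->
  (forall v, S v -> g v <= 0 -> 0 <= phi v) ->
  exists2 alpha, 0 <= alpha & forall v, S v -> 0 <= phi v + alpha * g v.
Proof.
move=> cS lphi lg Su gu phi0.
have [g0|] := pselect (forall w, S w -> g w <= 0).
  by exists 0 => // v Sv; rewrite mul0r addr0; apply: phi0 => //; exact: g0.
move=> /existsNP[w /not_implyP[Sw /negP]]; rewrite -ltNge => gw.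
have [|beta betaP] := @multiplier_two_sided S phi g u w cS lphi lg Su gu Sw gw.
  by move=> v Sv gv; apply: phi0 => //; rewrite gv.
exists (Num.max beta 0); first by rewrite le_max lexx orbT.
move=> v Sv; have := betaP v Sv; have := phi0 v Sv.
by case: (ltP beta 0) => b0; case: (leP (g v) 0) => gv; nra.
Qed.

Lemma sum_setD1_if (I : finType) (A : {set I}) i (c : R) (al g : I -> R) :
  i \in A -> \sum_(j in A) (if j == i then c else al j) * g j =
    c * g i + \sum_(j in (A :\ i)%SET) al j * g j.
Proof.
move=> iA; rewrite (big_setD1 i)//= eqxx; congr (_ + _).
by apply: eq_bigr => j; rewrite finset.in_setD1 => /andP[/negbTE->].
Qed.

Lemma multiplier_eq (J : finType) (h : J -> V -> R) (B : {set J}) e :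
  (forall j, scalar (h j)) -> (forall j, j \in B -> h j e = 0) ->
  forall S phi, is_convex_cone S -> core_point S e -> scalar phi ->
  (forall v, S v -> (forall j, j \in B -> h j v = 0) -> 0 <= phi v) ->
  exists beta : J -> R,
    forall v, S v -> 0 <= phi v + \sum_(j in B) beta j * h j v.
Proof.
move=> lh; move: {2}#|B| (erefl #|B|) => k.
elim: k B => [|k IH] B cB he S phi cS ceS lphi phi0.
  have B0 : B = finset.set0 by apply: cards0_eq.
  exists (fun=> 0) => v Sv; rewrite B0 big_set0 addr0; apply: phi0 => // j.
  by rewrite B0 finset.in_set0.
have [j jB] : exists j, j \in B by apply/set0Pn; rewrite -card_gt0 cB.
pose S' := S `&` [set v | h j v = 0].
have [||||||beta betaP] := IH (B :\ j)%SET _ _ S' phi.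
- by move: cB; rewrite (cardsD1 j) jB add1n => -[].
- by move=> i; rewrite finset.in_setD1 => /andP[_]; exact: he.
- exact: cone_cap_eq.
- by apply: core_cap_eq => //; exact: he.
- by [].
- move=> v [Sv /= hjv] hv; apply: phi0 => // i iB.
  by have [->//|ij] := eqVneq i j; apply: hv; rewrite finset.in_setD1 ij.
have [||c cP] := @multiplier_eq1 S e
    (fun v => phi v + \sum_(i in (B :\ j)%SET) beta i * h i v) (h j) cS ceS _ (lh j) (he j jB).
- move=> a u v; rewrite lphi scalar_sum//; ring.
- by move=> v Sv hjv; exact: betaP.
exists (fun i => if i == j then c else beta i) => v Sv.
rewrite (sum_setD1_if _ _ (h^~ v))//.
by have := cP v Sv; rewrite addrAC addrA.
Qed.

(** Induction on the number of inequalities.  An inequality that is strict at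
    some core point can be put into the cone without losing the core point, and
    is then split off by [multiplier_le1].  Moving the core point towards any
    admissible direction produces such an inequality unless all admissible
    directions are tangent to every inequality; this last case is where the
    sign of a multiplier has to be corrected. *)
Lemma multiplier_le (I : finType) (g : I -> V -> R) (A : {set I}) :
  (forall i, scalar (g i)) ->
  forall S e phi, is_convex_cone S -> core_point S e -> scalar phi ->
  (forall i, i \in A -> g i e <= 0) ->
  (forall v, S v -> (forall i, i \in A -> g i v <= 0) -> 0 <= phi v) ->
  exists2 alpha : I -> R, (forall i, 0 <= alpha i) &
    forall v, S v -> 0 <= phi v + \sum_(i in A) alpha i * g i v.
Proof.
move=> lg; move: {2}#|A| (erefl #|A|) => k.
elim: k A => [|k IH] A cA S e phi cS ceS lphi ge phi0.
  have A0 : A = finset.set0 by apply: cards0_eq.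
  exists (fun=> 0) => // v Sv; rewrite A0 big_set0 addr0; apply: phi0 => // j.
  by rewrite A0 finset.in_set0.
have cA1 i : i \in A -> #|(A :\ i)%SET| = k.
  by move=> iA; move: cA; rewrite (cardsD1 i) iA add1n => -[].
have lsum i (al : I -> R) psi : scalar psi ->
    scalar (fun v => psi v + \sum_(j in (A :\ i)%SET) al j * g j v).
  by move=> lpsi a u v; rewrite lpsi scalar_sum//; ring.
have slack e' i : core_point S e' -> (forall j, j \in A -> g j e' <= 0) ->
    i \in A -> g i e' < 0 ->
    exists2 alpha : I -> R, (forall i, 0 <= alpha i) &
      forall v, S v -> 0 <= phi v + \sum_(i in A) alpha i * g i v.
  move=> ce' ge' iA gi.
  have [|||||al al0 alP] := IH (A :\ i)%SET (cA1 i iA) (S `&` [set v | g i v <= 0]) e' phi.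
  - exact: cone_cap_le.
  - exact: core_cap_lt.
  - by [].
  - by move=> j; rewrite finset.in_setD1 => /andP[_]; exact: ge'.
  - move=> v [Sv /= giv] gv; apply: phi0 => // j jA.
    by have [->//|ji] := eqVneq j i; apply: gv; rewrite finset.in_setD1 ji.
  have [||||c c0 cP] := @multiplier_le1 S e'
    (fun v => phi v + \sum_(j in (A :\ i)%SET) al j * g j v) (g i) cS _ (lg i).
  - exact: lsum.
  - by case: ce'.
  - by [].
  - by move=> v Sv giv; exact: alP.
  exists (fun j => if j == i then c else al j).
    by move=> j; case: ifP.
  by move=> v Sv; rewrite (sum_setD1_if _ _ (g^~ v))//; have := cP v Sv; rewrite addrAC addrA.
have [[i [iA gi]]|noslack] := pselect (exists i, i \in A /\ g i e < 0).
  exact: slack gi.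
have {noslack}ge0 i : i \in A -> g i e = 0.
  move=> iA; apply/eqP; rewrite eq_le ge//= leNgt; apply/negP => gi.
  by apply: noslack; exists i.
have [[v [i [Sv gv iA gi]]]|tight] := pselect (exists v i,
    [/\ S v, forall j, j \in A -> g j v <= 0, i \in A & g i v < 0]).
  apply: (slack (e + v) i) => //.
  - case: cS => SD SZ; case: ceS => Se coree; split; first exact: SD.
    move=> u Su; have [eps eps0 Seu] := coree u Su; exists eps => //.
    by rewrite addrAC; exact: SD.
  - by move=> j jA; rewrite scalarD// ge0// add0r gv.
  - by rewrite scalarD// ge0// add0r.
(* every point of the cone satisfying the inequalities now satisfies them with
   equality.  In particular [g i] is nonnegative wherever the other inequalities
   hold, so the induction hypothesis with [g i] in the role of [phi] gives a
   combination of all inequalities in which [g i] has coefficient 1 and which is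
   nonnegative on the cone; adding [`|c|] times it turns the multiplier [c] of
   the equation [g i = 0] into a nonnegative one *)
have [i iA] : exists i, i \in A by apply/set0Pn; rewrite -card_gt0 cA.
have geD j : j \in (A :\ i)%SET -> g j e <= 0.
  by rewrite finset.in_setD1 => /andP[_ /ge0->].
have [|||//||al al0 alP] := IH _ (cA1 i iA) (S `&` [set v | g i v = 0]) e phi.
- exact: cone_cap_eq.
- by apply: core_cap_eq => //; exact: ge0.
- by [].
- move=> v [Sv /= giv] gv; apply: phi0 => // j jA.
  by have [->|ji] := eqVneq j i; rewrite ?giv//; apply: gv; rewrite finset.in_setD1 ji.
have [||c cP] := @multiplier_eq1 S e
  (fun v => phi v + \sum_(j in (A :\ i)%SET) al j * g j v) (g i) cS ceS _ (lg i) (ge0 i iA).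
- exact: lsum.
- by move=> v Sv giv; exact: alP.
have [|||//||de de0 deP] := IH _ (cA1 i iA) S e (g i).
- by [].
- by [].
- by [].
- move=> v Sv gv; rewrite leNgt; apply/negP => giv; apply: tight.
  exists v, i; split=> // j jA.
  by have [->|ji] := eqVneq j i; [exact: ltW|apply: gv; rewrite finset.in_setD1 ji].
exists (fun j => if j == i then c + `|c| else al j + `|c| * de j).
  move=> j; case: ifP => _; last by rewrite addr_ge0// mulr_ge0.
  by have := ler_norm (- c); rewrite normrN; lra.
move=> v Sv; rewrite (sum_setD1_if _ _ (g^~ v))//.
have -> : \sum_(j in (A :\ i)%SET) (al j + `|c| * de j) * g j v =
    \sum_(j in (A :\ i)%SET) al j * g j v + `|c| * \sum_(j in (A :\ i)%SET) de j * g j v.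
  by rewrite mulr_sumr -big_split/=; apply: eq_bigr => j _; ring.
have := cP v Sv; have := deP v Sv => dv cv.
have : 0 <= `|c| * (g i v + \sum_(j in (A :\ i)%SET) de j * g j v) by rewrite mulr_ge0.
by move: cv; lra.
Qed.

Lemma multiplier_le_eq (I J : finType) (g : I -> V -> R) (h : J -> V -> R)
    (A : {set I}) S e phi :
  (forall i, scalar (g i)) -> (forall j, scalar (h j)) -> scalar phi ->
  is_convex_cone S -> core_point S e ->
  (forall i, i \in A -> g i e <= 0) -> (forall j, h j e = 0) ->
  (forall v, S v -> (forall i, i \in A -> g i v <= 0) ->
    (forall j, h j v = 0) -> 0 <= phi v) ->
  exists alpha beta, (forall i, 0 <= alpha i) /\ forall v, S v ->
    0 <= phi v + \sum_(i in A) alpha i * g i v + \sum_j beta j * h j v.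
Proof.
move=> lg lh lphi cS ceS ge he phi0.
have [|||||al al0 alP] := @multiplier_le I g A lg
    (S `&` [set v | forall j, h j v = 0]) e phi.
- apply: cone_cap => //=.
    by move=> u v hu hv j; rewrite scalarD// hu hv addr0.
  by move=> c v _ hv j; rewrite scalarZ// hv mulr0.
- case: ceS => Se coree; split=> // v [Sv hv].
  have [eps eps0 Sev] := coree v Sv; exists eps => //; split=> //= j.
  by rewrite -scaleNr scalarD// scalarZ// he hv; ring.
- by [].
- by [].
- by move=> v [Sv hv] gv; exact: phi0.
have [|||be beP] := @multiplier_eq J h finset.setT e lh _ S
  (fun v => phi v + \sum_(i in A) al i * g i v) cS ceS.
- by move=> j _; exact: he.
- by move=> a u v; rewrite lphi scalar_sum//; ring.
- by move=> v Sv hv; apply: alP; split=> //= j; apply: hv; rewrite finset.in_setT.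
exists al, be; split=> // v Sv; have := beP v Sv.
suff -> : \sum_j be j * h j v = \sum_(j in finset.setT) be j * h j v by [].
by apply: eq_bigl => j; rewrite finset.in_setT.
Qed.

(** The radial cone of [K] at [x], shrunk by a condition at a second point [z]:
    without it [z - x] would not be a core point, because from [z] one cannot
    in general move away from an arbitrary point of [K] and remain in [K]. *)
Definition two_point_cone K (x z : V) : set V :=
  [set v | exists2 c : R, 0 < c & K (x + c *: v) /\ K (z - c *: v)].

Section two_point_cone.
Variables (K : set V) (x z : V).
Hypothesis convK : forall (t : R) u v, 0 <= t -> t <= 1 -> K u -> K v ->
  K ((1 - t) *: u + t *: v).
Hypotheses (Kx : K x) (Kz : K z).

Lemma two_point_cone_shrink v (c b : R) : 0 <= b -> b <= c ->
  K (x + c *: v) /\ K (z - c *: v) -> K (x + b *: v) /\ K (z - b *: v).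
Proof.
move=> b0; have [->|bn0] := eqVneq b 0; first by rewrite scale0r subr0 addr0.
move=> bc [Kxc Kzc]; have c0 : 0 < c by apply: lt_le_trans bc; rewrite lt_neqAle eq_sym bn0.
have t0 : 0 <= b / c by rewrite divr_ge0// ltW.
have t1 : b / c <= 1 by rewrite ler_pdivrMr// mul1r.
have bE : b = b / c * c by rewrite divfK// gt_eqF.
split.
  have -> : x + b *: v = (1 - b / c) *: x + (b / c) *: (x + c *: v).
    by rewrite scalerDr scalerA -bE addrA -scalerDl subrK scale1r.
  exact: convK.
have -> : z - b *: v = (1 - b / c) *: z + (b / c) *: (z - c *: v).
  by rewrite scalerBr scalerA -bE addrA -scalerDl subrK scale1r.
exact: convK.
Qed.

Lemma two_point_cone_convex_cone : is_convex_cone (two_point_cone K x z).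
Proof.
split=> [u v [c c0 Ku] [b b0 Kv]|a v a0 [c c0 Kv]].
  have m0 : 0 < Num.min c b by rewrite lt_min c0.
  have [Kxu Kzu] : K (x + Num.min c b *: u) /\ K (z - Num.min c b *: u).
    by apply: (two_point_cone_shrink _ _ Ku); rewrite ?ge_min ?lexx// ltW.
  have [Kxv Kzv] : K (x + Num.min c b *: v) /\ K (z - Num.min c b *: v).
    by apply: (two_point_cone_shrink _ _ Kv); rewrite ?ge_min ?lexx ?orbT// ltW.
  have half (y w : V) (s : R) : y + (s / 2) *: w = (1 - 2^-1) *: y + 2^-1 *: (y + s *: w).
    by rewrite scalerDr scalerA [2^-1 * s]mulrC addrA -scalerDl subrK scale1r.
  set m := Num.min c b in m0 Kxu Kzu Kxv Kzv.
  exists (m / 2); first by rewrite divr_gt0.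
  split.
    have -> : x + (m / 2) *: (u + v) =
        (1 - 2^-1) *: (x + m *: u) + 2^-1 *: (x + m *: v).
      have -> : 1 - 2^-1 = 2^-1 :> R by field.
      rewrite !scalerDr !scalerA [2^-1 * m]mulrC addrACA -scalerDl.
      by have -> : 2^-1 + 2^-1 = 1 :> R; [field|rewrite scale1r].
    by apply: convK => //; lra.
  have -> : z - (m / 2) *: (u + v) =
      (1 - 2^-1) *: (z - m *: u) + 2^-1 *: (z - m *: v).
    have -> : 1 - 2^-1 = 2^-1 :> R by field.
    rewrite !scalerBr !scalerDr !scalerA [2^-1 * m]mulrC addrACA -scalerDl opprD.
    by have -> : 2^-1 + 2^-1 = 1 :> R; [field|rewrite scale1r].
  by apply: convK => //; lra.
have a1 : 0 < a + 1 by lra.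
exists (c / (a + 1)); first exact: divr_gt0.
rewrite scalerA; apply: (two_point_cone_shrink _ _ Kv).
  by rewrite mulr_ge0// divr_ge0 ?ltW.
by rewrite mulrAC ler_pdivrMr//; nra.
Qed.

Lemma two_point_cone_core : core_point (two_point_cone K x z) (z - x).
Proof.
split; first by exists 1 => //; rewrite scale1r [x + _]addrC subrK opprB addrC subrK.
move=> v [c c0 [Kxc Kzc]]; exists c => //; exists 1 => //.
rewrite scale1r addrA [x + _]addrC subrK; split=> //.
by rewrite opprB opprB addrC addrA subrK addrC.
Qed.

End two_point_cone.
End multipliers.

(** * Dominated convergence and duality in L^p *)

Section Lspace_tools.
Context d (T : measurableType d) (R : realType).
Variable mu : {measure set T -> \bar R}.
Implicit Types (p q : \bar R) (f g : T -> R).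

Lemma ae_le_Lfun p f g : (1 <= p)%E -> measurable_fun setT f ->
  g \in Lfun mu p -> (\forall w \ae mu, `|f w| <= `|g w|) -> f \in Lfun mu p.
Proof.
move=> p1 mf /andP[/[!inE]/= mg Lg] fg; apply/andP; split; rewrite inE//=.
apply: le_lt_trans Lg; rewrite unlock /Lnorm.
case: p p1 => [r|_|//].
- rewrite lee_fin => r1; have r0 : 0 < r by rewrite (lt_le_trans _ r1).
  have mpow (h : T -> R) : measurable_fun setT h ->
      measurable_fun setT (fun x : T => `|(EFin \o h) x| `^ r)%E.
    move=> mh; apply: (measurableT_comp (measurable_poweR _)).
    by apply: measurableT_comp => //; exact/measurable_EFinP.
  apply: gt0_ler_poweR.
  + by rewrite invr_ge0 ltW.
  + by rewrite in_itv/= leey andbT integral_ge0// => x _; exact: poweR_ge0.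
  + by rewrite in_itv/= leey andbT integral_ge0// => x _; exact: poweR_ge0.
  apply: ae_ge0_le_integral => //.
  + by move=> x _; exact: poweR_ge0.
  + exact: mpow.
  + by move=> x _; exact: poweR_ge0.
  + exact: mpow.
  apply: filterS fg => x fgx _ /=.
  by rewrite lee_fin ge0_ler_powR ?nnegrE ?normr_ge0// ltW.
- case: ifPn => // _; apply: le_ess_sup.
  by apply: filterS fg => x fgx /=; rewrite lee_fin.
Qed.

Lemma bounded_Lfun_oo f (C : R) : measurable_fun setT f ->
  (\forall w \ae mu, `|f w| <= C) -> f \in Lfun mu +oo%E.
Proof.
move=> mf fC; apply/andP; split; rewrite inE//= /finite_norm unlock /Lnorm.
case: ifPn => // _; apply: (@le_lt_trans _ _ C%:E); last exact: ltry.
by apply/ess_supP; apply: filterS fC => w fw /=; rewrite lee_fin.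
Qed.

Lemma Lfun_oo_bounded f : f \in Lfun mu +oo%E ->
  exists C : R, \forall w \ae mu, `|f w| <= C.
Proof.
move=> /andP[/[!inE]/= mf]; rewrite /finite_norm unlock /Lnorm.
case: ifPn => [_ fy|mu0 _]; last first.
  have {}mu0 : mu setT = 0%E by apply/eqP; rewrite eq_le measure_ge0 leNgt mu0.
  by exists 0; exact: measure0_ae.
exists (fine (ess_sup mu (abse \o (EFin \o f)))).
apply: filterS (ess_sup_ge mu (abse \o (EFin \o f))) => w /= fw.
rewrite -lee_fin (le_trans fw)//.
have [->|supNy] := eqVneq (ess_sup mu (abse \o (EFin \o f))) -oo%E; first by rewrite leNye.
by rewrite fineK// fin_numE supNy/= -ltey.
Qed.

Lemma Lfun_powR_lty (r : R) f : 1 <= r -> f \in Lfun mu r%:E <->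
  measurable_fun setT f /\ (\int[mu]_w (`|f w| `^ r)%:E < +oo)%E.
Proof.
move=> r1; have r0 : r != 0 by rewrite gt_eqF// (lt_le_trans _ r1).
split=> [/andP[/[!inE]/= mf]|[mf fy]]; rewrite /finite_norm.
  by move=> /(poweR_lty r); rewrite powR_Lnorm.
apply/andP; split; rewrite inE//= /finite_norm.
by apply: (@lty_poweRy _ _ r) => //; rewrite powR_Lnorm.
Qed.

(** Hoelder's inequality for finite exponents; at the endpoints one factor is
    essentially bounded and the other integrable. *)
Lemma Lfun_mul_integrable p q f g : (1 <= p)%E -> (1 <= q)%E ->
  (p^-1 + q^-1 = 1)%E -> g \in Lfun mu q -> f \in Lfun mu p ->
  mu.-integrable setT (fun w => (g w * f w)%:E).
Proof.
have oo1 f' g' : f' \in Lfun mu 1 -> g' \in Lfun mu +oo%E ->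
    mu.-integrable setT (fun w => (g' w * f' w)%:E).
  move=> Lf Lg; have [C gC] := Lfun_oo_bounded Lg.
  move: (Lg) (Lf) => /andP[/[!inE]/= mg _] /andP[/[!inE]/= mf _].
  apply/(@Lfun1_integrable _ _ _ mu (fun w => g' w * f' w)).
  apply: (@ae_le_Lfun 1 (fun w => g' w * f' w) (fun w => C * f' w)) => //.
  - exact: measurable_funM.
  - rewrite (_ : (fun w => C * f' w) = C \o* f'); first exact: Lfun_scale.
    by apply/funext => w /=; rewrite mulrC.
  - apply: filterS gC => w gw; rewrite !normrM ler_wpM2r//.
    by rewrite (le_trans gw)// ler_norm.
move=> p1 q1 pq Lg Lf.
have p0 : p != 0%E by rewrite gt_eqF// (lt_le_trans _ p1).
have [py|py] := eqVneq p +oo%E.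
  move: pq; rewrite py invey add0e => /eqP; rewrite inve_eq1 => /eqP q1E.
  under eq_fun do rewrite mulrC.
  by apply: oo1; [rewrite -q1E|rewrite -py].
have [qy|qy] := eqVneq q +oo%E.
  move: pq; rewrite qy invey adde0 => /eqP; rewrite inve_eq1 => /eqP p1E.
  by apply: oo1; [rewrite -p1E|rewrite -qy].
case: p p1 p0 py pq Lf => [r|//|//]; case: q q1 qy Lg => [s|//|//].
rewrite !lee_fin => s1 _ Lg r1 r0 _ pq Lf.
have r_gt0 : 0 < r by rewrite (lt_le_trans _ r1).
have s_gt0 : 0 < s by rewrite (lt_le_trans _ s1).
have rs : r^-1 + s^-1 = 1.
  by apply: EFin_inj; rewrite -pq !inver !gt_eqF// EFinD.
move: (Lg) (Lf) => /andP[/[!inE]/= mg Ng] /andP[/[!inE]/= mf Nf].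
apply/(@Lfun1_integrable _ _ _ mu (fun w => g w * f w)).
apply/andP; split; rewrite inE/=; first exact: measurable_funM.
rewrite /finite_norm; apply: le_lt_trans (hoelder mu mg mf s_gt0 r_gt0 _) _.
  by rewrite addrC.
by rewrite lte_mul_pinfty ?ge0_fin_numE ?Lnorm_ge0.
Qed.

(** Total in [f], so that functionals of truncated functions can be written
    without carrying membership proofs. *)
Definition to_Lspace p (p1 : (1 <= p)%E) f : LspaceType mu p1 :=
  match @idP (f \in Lfun mu p) with
  | ReflectT Lf => Lspace_of (Lfun_Sub p1 Lf)
  | ReflectF _ => 0
  end.

Lemma to_LspaceE p (p1 : (1 <= p)%E) f : f \in Lfun mu p ->
  \forall w \ae mu, to_Lspace p1 f w = f w.
Proof.
move=> Lf; rewrite /to_Lspace; case: {-}_ / idP => // Lf'.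
by apply: filterS (Lspace_ofE (Lfun_Sub p1 Lf')) => w /(_ I).
Qed.

Section fixed_exponent.
Variables (p : \bar R) (p1 : (1 <= p)%E).
Implicit Types x y z : LspaceType mu p1.

Lemma Lspace_eq x y : (\forall w \ae mu, x w = y w) -> x = y.
Proof. by move=> xy; apply/Lspace_eqP; apply: filterS xy. Qed.

Lemma LspaceDE x y : \forall w \ae mu, (x + y) w = x w + y w.
Proof. exact: Lspace_addE. Qed.

Lemma LspaceNE x : \forall w \ae mu, (- x) w = - x w.
Proof. exact: Lspace_oppE. Qed.

Lemma LspaceZE (c : R) x : \forall w \ae mu, (c *: x) w = c * x w.
Proof. exact: Lspace_scaleE. Qed.

Lemma LspaceBE x y : \forall w \ae mu, (x - y) w = x w - y w.
Proof. by apply: filterS2 (LspaceDE x (- y)) (LspaceNE y) => w -> ->. Qed.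

Lemma Lspace0E : \forall w \ae mu, (0 : LspaceType mu p1) w = 0.
Proof. exact: Lspace_zeroE. Qed.

Lemma Lspace_lcE (a : R) x y : \forall w \ae mu, (a *: x + y) w = a * x w + y w.
Proof. by apply: filterS2 (LspaceDE (a *: x) y) (LspaceZE a x) => w -> ->. Qed.

End fixed_exponent.

Lemma norm_LspaceE (r : R) (p1 : (1 <= r%:E)%E) (x : LspaceType mu p1) :
  (`|x| `^ r)%:E = (\int[mu]_w (`|x w| `^ r)%:E)%E.
Proof.
have r0 : r != 0 by rewrite gt_eqF// (@lt_le_trans _ _ 1).
rewrite -[RHS](@powR_Lnorm _ _ _ mu (EFin \o x))//.
by rewrite -(finite_norm_fine (Lspace_repr x)).
Qed.

Lemma powR_cvgn0 (r : R) (u : nat -> R) : 0 < r -> (forall n, 0 <= u n) ->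
  u n @[n --> \oo] --> 0 -> u n `^ r @[n --> \oo] --> 0.
Proof.
move=> r0 u0 /cvgrPdist_lt cu; apply/cvgrPdist_lt => e e0.
have er0 : 0 < e `^ r^-1 by exact: powR_gt0.
near=> n; have : `|0 - u n| < e `^ r^-1 by near: n; exact: cu.
rewrite !sub0r !normrN !ger0_norm ?powR_ge0// => une.
rewrite -[ltRHS]powRr1; last exact: ltW.
rewrite -[X in _ < _ `^ X](@mulVf _ r) ?gt_eqF// powRrM.
by apply: gt0_ltr_powR => //; rewrite nnegrE ?u0// ltW.
Unshelve. all: by end_near. Qed.

(** Dominated convergence for the integrals of the r-th powers, with bound
    (2 |z|) ^ r, whence the restriction to finite exponents. *)
Lemma Lspace_dominated_cvg (r : R) (p1 : (1 <= r%:E)%E)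
    (x_ : nat -> LspaceType mu p1) (x z : LspaceType mu p1) :
  (forall n, \forall w \ae mu, `|x_ n w| <= `|z w|) ->
  (\forall w \ae mu, x_ n w @[n --> \oo] --> x w) ->
  x_ @ \oo --> x.
Proof.
move=> xz xx; have r1 : 1 <= r by [].
have r_gt0 : 0 < r by rewrite (lt_le_trans _ r1).
pose F n w := (`|(x_ n - x) w| `^ r)%:E.
have mF n : measurable_fun setT (F n).
  apply/measurable_EFinP; apply: (measurableT_comp (measurable_powR _)).
  by apply: measurableT_comp => //; exact: Lspace_measurable.
have aexz : \forall w \ae mu, forall n, `|x_ n w| <= `|z w| by exact: ae_foralln.
have aeB : \forall w \ae mu, forall n, (x_ n - x) w = x_ n w - x w.
  by apply: ae_foralln => n; exact: LspaceBE.
have xz_lim : \forall w \ae mu, `|x w| <= `|z w|.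
  apply: filterS2 xx aexz => w xw zw.
  have : `|x_ n w| @[n --> \oo] --> `|x w| by apply: cvg_norm.
  move=> /cvg_lim <-//; apply: limr_le; last exact: nearW.
  by apply/cvg_ex; eexists; apply: cvg_norm; exact: xw.
have intz : mu.-integrable setT (fun w => ((2 `^ r)%:E * (`|z w| `^ r)%:E)%E).
  apply: integrableZl => //.
  by apply: Lfun_integrable => //; exact: Lspace_Lfun.
have [|||_ _] := @dominated_convergence _ _ _ mu setT measurableT F (cst 0%E)
    (fun w => ((2 `^ r)%:E * (`|z w| `^ r)%:E)%E) mF _ _ intz.
- exact: measurable_cst.
- apply: filterS2 xx aeB => w xw Bw _; rewrite /F.
  apply: cvg_EFin; first exact: nearW.
  apply: powR_cvgn0 => //; apply/cvgr0Pnorm_lt => e e0.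
  under eq_near do rewrite Bw normr_id distrC.
  by move/cvgrPdist_lt : xw; exact.
- apply: filterS3 aeB xz_lim aexz => w Bw xzw xz_w n _.
  rewrite /F gee0_abs ?lee_fin ?powR_ge0// -powRM//.
  apply: ge0_ler_powR; rewrite ?nnegrE ?mulr_ge0//; first exact: ltW.
  rewrite Bw (le_trans (ler_normB _ _))//; have := xz_w n; lra.
move=> intF0.
have norm0 : `|x_ n - x| `^ r @[n --> \oo] --> 0.
  have : (`|x_ n - x| `^ r)%:E @[n --> \oo] --> 0%:E; last by move/fine_cvg.
  move: intF0; rewrite integral0.
  by under eq_fun do rewrite /F -norm_LspaceE.
rewrite -subr_cvg0; apply: norm_cvg0.
have -> : (fun n => `|x_ n - x|) = (fun n => (`|x_ n - x| `^ r) `^ r^-1).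
  by apply/funext => n; rewrite -powRrM mulfV ?powRr1// gt_eqF.
by apply: powR_cvgn0 => //; rewrite ?invr_gt0// => n; exact: powR_ge0.
Qed.

Section duality.
Variables (p q : \bar R) (p1 : (1 <= p)%E) (q1 : (1 <= q)%E).
Hypothesis pq : (p^-1 + q^-1 = 1)%E.
Implicit Types (x z : LspaceType mu p1) (y : LspaceType mu q1).

Lemma Lpair_integrable y x : mu.-integrable setT (EFin \o (fun w => y w * x w)).
Proof. exact: (@Lfun_mul_integrable p q x y p1 q1 pq (Lspace_Lfun y) (Lspace_Lfun x)). Qed.

Lemma Lpair_eq y x (f : T -> R) : measurable_fun setT f ->
  (\forall w \ae mu, y w * x w = f w) -> Lpair y x = \int[mu]_w f w.
Proof.
move=> mf yxf; congr fine; apply: ae_eq_integral => //.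
- by apply/measurable_EFinP; apply: measurable_funM; exact: Lspace_measurable.
- exact/measurable_EFinP.
- by apply: filterS yxf => w -> _.
Qed.

Lemma mLpair y x : measurable_fun setT (fun w => y w * x w).
Proof. by apply: measurable_funM; exact: Lspace_measurable. Qed.

Lemma Lpair_scalar y : scalar (Lpair y : LspaceType mu p1 -> R).
Proof.
move=> a x z; rewrite (@Lpair_eq y _ (fun w => a * (y w * x w) + y w * z w)).
- rewrite RintegralD//; first by rewrite RintegralZl//; exact: Lpair_integrable.
    exact: (integrableZl measurableT a (Lpair_integrable y x)).
  exact: Lpair_integrable.
- apply: measurable_funD; last exact: mLpair.
  by apply: measurable_funM => //; exact: mLpair.
- by apply: filterS (Lspace_lcE a x z) => w ->; ring.
Qed.

Lemma Lpair_scalarl x : scalar (fun y => Lpair y x).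
Proof.
move=> a y z; rewrite (@Lpair_eq _ x (fun w => a * (y w * x w) + z w * x w)).
- rewrite RintegralD//; first by rewrite RintegralZl//; exact: Lpair_integrable.
    exact: (integrableZl measurableT a (Lpair_integrable y x)).
  exact: Lpair_integrable.
- apply: measurable_funD; last exact: mLpair.
  by apply: measurable_funM => //; exact: mLpair.
- by apply: filterS (Lspace_lcE a y z) => w ->; ring.
Qed.

(** Unlike [Lspace_dominated_cvg] this includes p = +oo, where dominated
    pointwise convergence is only weak-star convergence. *)
Lemma Lpair_dominated_cvg y (x_ : nat -> LspaceType mu p1) x z :
  (forall n, \forall w \ae mu, `|x_ n w| <= `|z w|) ->
  (\forall w \ae mu, x_ n w @[n --> \oo] --> x w) ->
  Lpair y (x_ n) @[n --> \oo] --> Lpair y x.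
Proof.
move=> xz xx; have aexz := ae_foralln xz.
have iyz := integrable_abse (Lpair_integrable y z).
have [||||iyx _ +] := @dominated_convergence _ _ _ mu setT measurableT
  (fun n w => (y w * x_ n w)%:E) (fun w => (y w * x w)%:E) _ _ _ _ iyz.
- by move=> n; apply/measurable_EFinP; exact: mLpair.
- by apply/measurable_EFinP; exact: mLpair.
- apply: filterS xx => w xw _; apply: cvg_EFin; first exact: nearW.
  by apply: cvgM => //; exact: cvg_cst.
- apply: filterS aexz => w xzw n _ /=.
  by rewrite lee_fin !normrM ler_wpM2l.
rewrite /Lpair /Rintegral => cv; apply: fine_cvg; rewrite fineK//.
exact: integrable_fin_num.
Qed.

End duality.
End Lspace_tools.

(** * An integrable weight *)

(** The series of the indicators of a countable cover by sets of finite measure,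
    with coefficients making both the values and the integral at most the sum
    of 2 ^ (- n - 1). *)
Lemma positive_integrable_weight d (T : measurableType d) (R : realType)
    (mu : {sigma_finite_measure set T -> \bar R}) :
  exists eta : T -> R, [/\ measurable_fun setT eta,
    forall w, 0 < eta w <= 1 & mu.-integrable setT (EFin \o eta)].
Proof.
have [F Fcov Ffin] := sigma_finiteT mu.
have mF n : measurable (F n) by case: (Ffin n).
pose c n : R := 1 / (2 ^ n.+1)%:R / (1 + fine (mu (F n))).
have den n : 0 < 1 + fine (mu (F n)) :> R by rewrite ltr_pwDl// fine_ge0.
have c0 n : 0 < c n by rewrite /c divr_gt0// divr_gt0// ltr0n expn_gt0.
have c1 n : c n <= 1 / (2 ^ n.+1)%:R.
  rewrite /c ler_pdivrMr// ler_peMr ?divr_ge0// lerDl fine_ge0//.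
have cF n : ((c n)%:E * mu (F n) <= (1 / (2 ^ n.+1)%:R)%:E)%E.
  have Fn : mu (F n) \is a fin_num by rewrite ge0_fin_numE//; case: (Ffin n).
  rewrite -(fineK Fn) -EFinM lee_fin /c mulrAC ler_pdivrMr//.
  by apply: ler_wpM2l; [rewrite divr_ge0|rewrite lerDr].
pose h n w := ((c n)%:E * (\1_(F n) w)%:E)%E : \bar R.
have h0 n w : (0 <= h n w)%E by rewrite mule_ge0// lee_fin// ltW.
have mh n : measurable_fun setT (h n).
  by apply: emeasurable_funM => //; apply/measurable_EFinP.
pose H w := (\sum_(n <oo) h n w)%E.
have mH : measurable_fun setT H.
  have := @ge0_emeasurable_sum _ _ _ setT h xpredT (fun k x _ _ => h0 k x) (fun k _ => mh k).
  by [].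
have H0 w : (0 < H w)%E.
  have [n _ Fnw] : (\bigcup_i F i) w by rewrite -Fcov.
  have : (h n w <= H w)%E.
    apply: le_trans (nneseries_lim_ge n.+1 _); last by move=> k _ _; exact: h0.
    by rewrite big_nat_recr//= leeDr// sume_ge0.
  apply: lt_le_trans; rewrite /h indicE mem_set// mule1 lte_fin//.
have H1 w : (H w <= 1)%E.
  apply: le_trans (epsilon_trick0 xpredT (@ler01 R)).
  apply: lee_nneseries => // n _; rewrite /h -EFinM lee_fin.
  apply: le_trans (c1 n); rewrite indicE; case: (_ \in _); rewrite ?mulr1 ?mulr0//.
  exact: ltW.
have Hfin w : H w \is a fin_num.
  by rewrite ge0_fin_numE ?(ltW (H0 w))// (le_lt_trans (H1 w))// ltry.
exists (fine \o H); split.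
- exact: measurableT_comp.
- by move=> w /=; rewrite -!lee_fin -lte_fin fineK// H0 H1.
- have -> : EFin \o (fine \o H) = H by apply/funext => w /=; rewrite fineK.
  apply/integrableP; split=> //.
  under eq_integral do rewrite gee0_abs ?(ltW (H0 _))//.
  rewrite integral_nneseries//.
  apply: (@le_lt_trans _ _ 1%E); last exact: ltry.
  apply: le_trans (epsilon_trick0 xpredT (@ler01 R)).
  apply: lee_nneseries => [n _ _|n _]; first by apply: integral_ge0.
  rewrite /h ge0_integralZl//; last 2 first.
  + exact/measurable_EFinP.
  + by rewrite lee_fin ltW.
  by rewrite integral_indic// setIT; exact: cF.
Qed.

(** For finite p the bound eta <= 1 gives eta ^ p <= eta. *)
Lemma weight_Lfun d (T : measurableType d) (R : realType)
    (mu : {measure set T -> \bar R}) (p : \bar R) (eta : T -> R) :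
  (1 <= p)%E -> measurable_fun setT eta -> (forall w, 0 < eta w <= 1) ->
  mu.-integrable setT (EFin \o eta) -> eta \in Lfun mu p.
Proof.
move=> p1 meta eta01 ieta.
have eta1 w : `|eta w| <= 1 by have /andP[? ?] := eta01 w; rewrite ger0_norm// ltW.
case: p p1 => [r r1|_|//]; last by apply: (@bounded_Lfun_oo _ _ _ _ _ 1) => //; exact: aeW.
apply/Lfun_powR_lty => //; split=> //.
move/integrableP : ieta => [_]; apply: le_lt_trans.
apply: ge0_le_integral => //.
- apply/measurable_EFinP; apply: (measurableT_comp (measurable_powR _)).
  exact: measurableT_comp.
- by apply: measurableT_comp => //; exact/measurable_EFinP.
move=> w _; rewrite /= lee_fin.
rewrite -[leRHS](@powRr1 _ `|eta w|)//; apply: ger_powR => //.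
by rewrite eta1 andbT normr_gt0 gt_eqF//; have /andP[] := eta01 w.
Qed.

(** * Riesz representation of the dual of L^p *)

Section truncation_tools.
Context d (T : measurableType d) (R : realType).
Variable mu : {measure set T -> \bar R}.

Lemma measurable_funV_gt0 (f : T -> R) : measurable_fun setT f ->
  (forall w, 0 < f w) -> measurable_fun setT (fun w => (f w)^-1).
Proof.
move=> mf f0; have -> : (fun w => (f w)^-1) = (fun w => f w `^ (- 1)).
  by apply/funext => w; rewrite powR_inv1// ltW.
exact: (measurableT_comp (measurable_powR _) mf).
Qed.

Lemma ae_eq0_of_Rintegral_le0 (f : T -> R) : mu.-integrable setT (EFin \o f) ->
  (forall w, 0 <= f w) -> \int[mu]_w f w <= 0 -> \forall w \ae mu, f w = 0.
Proof.
move=> intf f0 If; have mf := measurable_int mu intf.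
have I0 : (\int[mu]_w `|(EFin \o f) w| = 0)%E.
  under eq_integral do rewrite gee0_abs ?lee_fin//.
  apply/eqP; rewrite eq_le integral_ge0 ?andbT; last by move=> w _; rewrite lee_fin.
  by rewrite -[leLHS]fineK ?lee_fin//; exact: integrable_fin_num.
have /(ae_eq_integral_abs mu measurableT mf) := I0.
by apply: filterS => w /(_ I) /= [].
Qed.

Lemma Lfun_lc (p : \bar R) (a : R) (f g : T -> R) : (1 <= p)%E ->
  f \in Lfun mu p -> g \in Lfun mu p -> (fun w => a * f w + g w) \in Lfun mu p.
Proof.
move=> p1 Lf Lg; have fE := to_LspaceE p1 Lf; have gE := to_LspaceE p1 Lg.
have aeE : \forall w \ae mu,
    (a *: to_Lspace mu p1 f + to_Lspace mu p1 g) w = a * f w + g w.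
  by apply: filterS3 (Lspace_lcE a (to_Lspace mu p1 f) (to_Lspace mu p1 g)) fE gE => w -> -> ->.
apply: (ae_le_Lfun p1 _ (Lspace_Lfun (a *: to_Lspace mu p1 f + to_Lspace mu p1 g))).
- move: (Lf) (Lg) => /andP[/[!inE]/= mf _] /andP[/[!inE]/= mg _].
  by apply: measurable_funD => //; exact: measurable_funM.
- by apply: filterS aeE => w ->.
Qed.

End truncation_tools.

Section riesz_representation.
Context d (T : measurableType d) (R : realType).
Variable mu : {sigma_finite_measure set T -> \bar R}.
Variables (r : R) (p1 : (1 <= r%:E)%E).
Variable phi : LspaceType mu p1 -> R.
Hypothesis phi_scalar : scalar phi.
Hypothesis phi_continuous : continuous phi.
Variable M : R.
Hypothesis phi_bounded : forall x, `|phi x| <= M * `|x|.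

Variable eta : T -> R.
Hypothesis meta : measurable_fun setT eta.
Hypothesis eta01 : forall w, 0 < eta w <= 1.
Hypothesis ieta : mu.-integrable setT (EFin \o eta).

Let eta_gt0 w : 0 < eta w. Proof. by case/andP : (eta01 w). Qed.

Local Notation cls := (to_Lspace mu p1).

Definition weighted (s : T -> R) : LspaceType mu p1 := cls (fun w => eta w * s w).

Definition bounded_measurable (s : T -> R) :=
  measurable_fun setT s /\ exists C, forall w, `|s w| <= C.

Lemma weighted_Lfun s : bounded_measurable s ->
  (fun w => eta w * s w) \in Lfun mu r%:E.
Proof.
move=> [ms [C sC]]; have Leta := weight_Lfun p1 meta eta01 ieta.
apply: (ae_le_Lfun p1 _ (Lfun_lc C p1 Leta Leta)); first exact: measurable_funM.
apply: aeW => w; have C0 := le_trans (normr_ge0 _) (sC w).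
rewrite normrM (ger0_norm (ltW (eta_gt0 w))) [leRHS]ger0_norm; last first.
  by rewrite addr_ge0 ?mulr_ge0// ltW.
have := ler_wpM2r (ltW (eta_gt0 w)) (sC w); have := eta_gt0 w.
by rewrite [`|_| * _]mulrC; lra.
Qed.

Lemma weightedE s : bounded_measurable s ->
  \forall w \ae mu, weighted s w = eta w * s w.
Proof. by move=> bs; exact: to_LspaceE (weighted_Lfun bs). Qed.

Lemma weighted_lc (a : R) s t : bounded_measurable s -> bounded_measurable t ->
  bounded_measurable (fun w => a * s w + t w) ->
  weighted (fun w => a * s w + t w) = a *: weighted s + weighted t.
Proof.
move=> bs bt bst; apply: Lspace_eq.
apply: filterS2 (filterI (weightedE bs) (weightedE bt))
  (filterI (weightedE bst) (Lspace_lcE a (weighted s) (weighted t))).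
by move=> w [sE tE] [stE ->]; rewrite stE sE tE; ring.
Qed.

(** The convergence of weighted bounded functions is dominated by [C * eta], so
    it holds in the norm of L^p and passes through [phi]. *)
Lemma phi_weighted_cvg (s_ : nat -> T -> R) s (C : R) :
  (forall n, measurable_fun setT (s_ n)) -> (forall n w, `|s_ n w| <= C) ->
  bounded_measurable s -> (forall w, s_ n w @[n --> \oo] --> s w) ->
  phi (weighted (s_ n)) @[n --> \oo] --> phi (weighted s).
Proof.
move=> ms_ s_C bs s_s.
apply: (cvg_comp (fun n => weighted (s_ n)) phi _ (@phi_continuous (weighted s))).
have bs_ n : bounded_measurable (s_ n) by split=> //; exists C.
have bC : bounded_measurable (cst C).
  by split; [exact: measurable_cst|exists `|C|].
apply: (@Lspace_dominated_cvg _ _ _ _ r p1 _ _ (weighted (cst C))).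
- move=> n; apply: filterS2 (weightedE (bs_ n)) (weightedE bC) => w -> ->.
  by rewrite !normrM ler_wpM2l// (le_trans (s_C n w)) ?ler_norm.
- have := ae_foralln (fun n => weightedE (bs_ n)).
  apply: filterS2 (weightedE bs) => w -> wE; under eq_fun do rewrite wE.
  by apply: cvgM; [exact: cvg_cst|exact: s_s].
Qed.

Definition weighted_charge (A : set T) : \bar R := (phi (weighted \1_A))%:E.

Lemma bounded_indic (A : set T) : measurable A -> bounded_measurable \1_A.
Proof.
move=> mA; split; first exact: measurable_indic.
by exists 1 => w; rewrite indicE; case: (_ \in _); rewrite ?normr1 ?normr0.
Qed.

Lemma weighted_charge0 : weighted_charge set0 = 0%E.
Proof.
have -> : weighted_charge set0 = (phi 0)%:E; last by rewrite scalar0.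
congr (phi _)%:E; apply: Lspace_eq.
apply: filterS2 (weightedE (bounded_indic measurable0)) (@Lspace0E _ _ _ mu _ p1).
by move=> w -> ->; rewrite indic0 mulr0.
Qed.

Lemma weighted_charge_fin A : measurable A -> weighted_charge A \is a fin_num.
Proof. by []. Qed.

(** Partial sums are values of the charge on finite unions, whose indicators
    converge boundedly to that of the countable union. *)
Lemma weighted_charge_sigma_additive : semi_sigma_additive weighted_charge.
Proof.
move=> F mF tF mUF.
have sumE n : \sum_(0 <= i < n) weighted_charge (F i) =
    weighted_charge (\big[setU/set0]_(0 <= i < n) F i).
  elim: n => [|n IH]; first by rewrite !big_nil weighted_charge0.
  have mU : measurable (\big[setU/set0]_(0 <= i < n) F i).
    by apply: bigsetU_measurable.
  have UE : \1_(\big[setU/set0]_(0 <= i < n.+1) F i) =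
      (fun w => 1 * \1_(\big[setU/set0]_(0 <= i < n) F i) w + \1_(F n) w) :> (T -> R).
    apply/funext => w; rewrite mul1r big_nat_recr//= !indicE in_setU.
    have [wn|wn] := boolP (w \in F n); last by rewrite orbF addr0.
    rewrite orbT (_ : _ \in _ = false) ?add0r//; apply/negbTE/negP.
    rewrite inE big_mkord -bigcup_mkord => -[i /= im Fiw].
    move/trivIsetP : tF => /(_ i n I I); rewrite neq_ltn im => /(_ isT).
    move=> FiFn; suff : (F i `&` F n) w by rewrite FiFn.
    by split=> //; exact: set_mem.
  rewrite big_nat_recr//= IH /weighted_charge -EFinD UE weighted_lc.
  - by rewrite phi_scalar mul1r.
  - exact: bounded_indic.
  - exact: bounded_indic.
  - by rewrite -UE; apply: bounded_indic; exact: bigsetU_measurable.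
under eq_fun do rewrite sumE.
apply: cvg_EFin; first exact: nearW.
apply: (phi_weighted_cvg (C := 1)).
- by move=> n; apply: measurable_indic; exact: bigsetU_measurable.
- by move=> n w; rewrite indicE; case: (_ \in _); rewrite ?normr1 ?normr0.
- exact: bounded_indic.
move=> w; have [[i _ Fiw]|nFw] := pselect ((\bigcup_n F n) w).
  apply: cvg_near_cst; exists i.+1 => // n /= lin.
  have Unw : (\big[setU/set0]_(0 <= i < n) F i) w.
    by rewrite big_mkord -bigcup_mkord; exists i.
  by rewrite !indicE !mem_set//; exists i.
apply: cvg_near_cst; apply: nearW => n; rewrite !indicE !memNset//.
by rewrite big_mkord -bigcup_mkord => -[i _ Fiw]; apply: nFw; exists i.
Qed.

HB.instance Definition _ := isCharge.Build _ T R weighted_charge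
  weighted_charge0 weighted_charge_fin weighted_charge_sigma_additive.

Lemma weighted_charge_dominated : weighted_charge `<< mu.
Proof.
move=> N N0 A mA AN; have A0 : mu A = 0%E by exact: N0.
have -> : weighted_charge A = (phi 0)%:E; last by rewrite scalar0.
congr (phi _)%:E; apply: Lspace_eq.
have nA : \forall w \ae mu, ~ A w.
  by exists A; split=> // w /= /contrapT.
apply: filterS3 nA (weightedE (bounded_indic mA)) (@Lspace0E _ _ _ mu _ p1).
by move=> w nAw -> ->; rewrite indicE memNset// mulr0.
Qed.

Lemma weighted_density : exists rho : T -> R,
  mu.-integrable setT (EFin \o rho) /\
  forall A, measurable A -> phi (weighted \1_A) = \int[mu]_w (rho w * \1_A w).
Proof.
pose f := Radon_Nikodym weighted_charge mu.
have f_fin w : f w \is a fin_num.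
  exact: Radon_Nikodym_fin_num weighted_charge_dominated.
have fE : EFin \o (fine \o f) = f by apply/funext => w /=; rewrite fineK.
exists (fine \o f); split.
  by rewrite fE; exact: Radon_Nikodym_integrable weighted_charge_dominated.
move=> A mA; apply: EFin_inj.
rewrite -[LHS]/(weighted_charge A).
rewrite (Radon_Nikodym_integral weighted_charge_dominated mA).
rewrite -/f integral_mkcond -[LHS]fineK.
  congr (fine _)%:E; apply: eq_integral => w _.
  by rewrite epatch_indic EFinM -[(_ _)%:E]/((EFin \o (fine \o f)) w) fE.
rewrite -integral_mkcond; apply: integrable_fin_num => //.
apply: (integrableS measurableT) => //.
exact: Radon_Nikodym_integrable weighted_charge_dominated.
Qed.

Section density.
Import HBNNSimple.
Variable rho : T -> R.
Hypothesis irho : mu.-integrable setT (EFin \o rho).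
Hypothesis rho_indic : forall A, measurable A ->
  phi (weighted \1_A) = \int[mu]_w (rho w * \1_A w).

Let mrho : measurable_fun setT rho.
Proof. by apply/measurable_EFinP; exact: measurable_int irho. Qed.

Lemma density_integrable s : bounded_measurable s ->
  mu.-integrable setT (EFin \o (fun w => rho w * s w)).
Proof.
move=> [ms [C sC]].
apply: (@le_integrable _ _ _ mu setT measurableT _ (fun w => (C%:E * (rho w)%:E)%E)).
- by apply/measurable_EFinP; exact: measurable_funM.
- move=> w _ /=; rewrite lee_fin !normrM mulrC ler_wpM2r//.
  by rewrite (le_trans (sC w)) ?ler_norm.
- exact: (integrableZl measurableT C irho).
Qed.

Lemma bounded_lc (a : R) s t : bounded_measurable s -> bounded_measurable t ->
  bounded_measurable (fun w => a * s w + t w).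
Proof.
move=> [ms [C sC]] [mt [D tD]]; split.
  by apply: measurable_funD => //; exact: measurable_funM.
exists (`|a| * C + D) => w; rewrite (le_trans (ler_normD _ _))// lerD// normrM.
by rewrite ler_wpM2l.
Qed.

(** The class of functions [s] on which the density of the charge computes
    [phi (eta * s)]; the lemmas below enlarge it from indicators to all bounded
    measurable functions. *)
Definition density_agrees (s : T -> R) :=
  bounded_measurable s /\ phi (weighted s) = \int[mu]_w (rho w * s w).

Lemma density_agrees_lc (a : R) s t : density_agrees s -> density_agrees t ->
  density_agrees (fun w => a * s w + t w).
Proof.
move=> [bs sE] [bt tE]; have bst := bounded_lc a bs bt; split=> //.
rewrite weighted_lc// phi_scalar sE tE -RintegralZl//; last exact: density_integrable.
rewrite -RintegralD//; last 2 first.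
- exact: (integrableZl measurableT a (density_integrable bs)).
- exact: density_integrable.
by apply: eq_Rintegral => w _; ring.
Qed.

Lemma density_agrees_indic A : measurable A -> density_agrees \1_A.
Proof. by move=> mA; split; [exact: bounded_indic|exact: rho_indic]. Qed.

Lemma density_agrees_sum (I : Type) (l : seq I) (c : I -> R) (A : I -> set T) :
  (forall i, measurable (A i)) ->
  density_agrees (fun w => \sum_(i <- l) c i * \1_(A i) w).
Proof.
move=> mA; elim: l => [|i l IH].
  have -> : (fun w => \sum_(i <- [::]) c i * \1_(A i) w) = \1_set0.
    by apply/funext => w; rewrite big_nil indic0.
  exact: density_agrees_indic.
have -> : (fun w => \sum_(i <- i :: l) c i * \1_(A i) w) =
    (fun w => c i * \1_(A i) w + \sum_(i <- l) c i * \1_(A i) w).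
  by apply/funext => w; rewrite big_cons.
by apply: density_agrees_lc => //; exact: density_agrees_indic.
Qed.

Lemma density_agrees_cvg (s_ : nat -> T -> R) s (C : R) :
  (forall n, density_agrees (s_ n)) -> (forall n w, `|s_ n w| <= C) ->
  bounded_measurable s -> (forall w, s_ n w @[n --> \oo] --> s w) ->
  density_agrees s.
Proof.
move=> As_ s_C bs s_s; split=> //.
have ms_ n : measurable_fun setT (s_ n) by case: (As_ n) => -[].
have cphi := phi_weighted_cvg ms_ s_C bs s_s.
have iC : mu.-integrable setT (fun w => `|(C%:E * (rho w)%:E)|%E).
  exact: integrable_abse (integrableZl measurableT C irho).
have [||||_ _ +] := @dominated_convergence _ _ _ mu setT measurableT
  (fun n w => (rho w * s_ n w)%:E) (fun w => (rho w * s w)%:E) _ _ _ _ iC.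
- by move=> n; apply/measurable_EFinP; exact: measurable_funM.
- by apply/measurable_EFinP; case: bs => ms _; exact: measurable_funM.
- apply: aeW => w _; apply: cvg_EFin; first exact: nearW.
  by apply: cvgM => //; exact: cvg_cst.
- apply: aeW => w n _ /=; rewrite lee_fin !normrM mulrC ler_wpM2r//.
  by rewrite (le_trans (s_C n w)) ?ler_norm.
move=> cint.
have {}cint : \int[mu]_w (rho w * s_ n w) @[n --> \oo] --> \int[mu]_w (rho w * s w).
  apply: fine_cvg; rewrite fineK//; apply: integrable_fin_num => //.
  exact: density_integrable.
have E n : phi (weighted (s_ n)) = \int[mu]_w (rho w * s_ n w) by case: (As_ n).
move: cphi; under eq_fun do rewrite E.
by move=> cphi; apply: cvg_unique cphi cint.
Qed.

Lemma density_agrees_ge0 s : bounded_measurable s -> (forall w, 0 <= s w) ->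
  density_agrees s.
Proof.
move=> bs s0; have [ms [C sC]] := bs.
have mEs : measurable_fun setT (EFin \o s) by exact/measurable_EFinP.
pose a n : T -> R := nnsfun_approx measurableT mEs n.
have aE n : a n = approx setT (EFin \o s) n by exact: nnsfun_approxE.
apply: (@density_agrees_cvg a s C) => //.
- move=> n.
  have -> : a n = (fun w => \sum_(y <- finmap.enum_fset (fset_set (range (a n))))
      y * \1_(a n @^-1` [set y]) w).
    by apply/funext => w; rewrite {1}/a fimfunE fsbig_finite.
  by apply: density_agrees_sum => y; exact: measurable_sfunP.
- move=> n w; rewrite ger0_norm; last exact: fun_ge0.
  apply: le_trans (sC w); rewrite ger0_norm// aE -lee_fin.
  by apply: (@le_approx _ _ _ setT (EFin \o s) n w) => // t _; rewrite lee_fin.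
- move=> w; have := @cvg_nnsfun_approx _ _ _ setT measurableT _ mEs _ w I.
  by move=> /(_ (fun x _ => s0 x)) /fine_cvg.
Qed.

Lemma density_agrees_bounded s : bounded_measurable s -> density_agrees s.
Proof.
move=> bs; have [ms [C sC]] := bs.
have bC : bounded_measurable (cst C).
  by split; [exact: measurable_cst|exists `|C|].
have AC : density_agrees (cst C).
  apply: density_agrees_ge0 => // w; exact: le_trans (sC w).
have AsC : density_agrees (fun w => 1 * s w + C).
  apply: density_agrees_ge0; first exact: (bounded_lc 1 bs bC).
  by move=> w; rewrite mul1r -lerBlDr sub0r; have := sC w; rewrite ler_norml => /andP[].
have -> : s = (fun w => (- 1) * cst C w + (1 * s w + C)).
  by apply/funext => w /=; ring.
exact: density_agrees_lc.
Qed.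

(** The weight is divided out again: the integral of [rho * s] is that of
    [riesz_fun * (eta * s)]. *)
Definition riesz_fun (w : T) := rho w / eta w.

Lemma riesz_funE w : riesz_fun w * eta w = rho w.
Proof. by rewrite /riesz_fun divfK// gt_eqF. Qed.

Lemma measurable_riesz_fun : measurable_fun setT riesz_fun.
Proof. by apply: measurable_funM => //; exact: measurable_funV_gt0. Qed.

Let y := riesz_fun.
Let my : measurable_fun setT y := measurable_riesz_fun.

Let sg w : R := if 0 <= rho w then 1 else -1.

Let msg : measurable_fun setT sg.
Proof.
apply: measurable_fun_ifT => //; apply: measurable_fun_ler => //.
Qed.

Let sg_norm w : `|sg w| = 1.
Proof. by rewrite /sg; case: ifP; rewrite ?normrN normr1. Qed.

Let rho_sg w : rho w * sg w = `|rho w|.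
Proof.
rewrite /sg; case: ifPn => [h|]; first by rewrite mulr1 ger0_norm.
by rewrite -ltNge => h; rewrite mulrN1 ltr0_norm.
Qed.

Lemma norm_weighted s : bounded_measurable s ->
  (`|weighted s| `^ r)%:E = (\int[mu]_w (`|eta w * s w| `^ r)%:E)%E.
Proof.
move=> bs; rewrite norm_LspaceE.
have mpow (f : T -> R) : measurable_fun setT f ->
    measurable_fun setT (fun w => (`|f w| `^ r)%:E).
  move=> mf; apply/measurable_EFinP; apply: (measurableT_comp (measurable_powR _)).
  exact: measurableT_comp.
apply: ae_eq_integral => //.
- by apply: mpow; exact: Lspace_measurable.
- by apply: mpow; apply: measurable_funM => //; case: bs.
- by apply: filterS (weightedE bs) => w -> _.
Qed.

(** Testing [phi] on [eta * sg rho] restricted to the set where |rho / eta|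
    exceeds the bound [M] of [phi] shows that this set is negligible. *)
Lemma riesz_fun_Lfun_oo : r = 1 -> riesz_fun \in Lfun mu +oo%E.
Proof.
move=> r1; apply: (@bounded_Lfun_oo _ _ _ _ _ M) => //.
pose E w := M < `|y w|.
have mE : measurable_fun setT E.
  by apply: measurable_fun_ltr => //; exact: measurableT_comp.
pose e w : R := if E w then 1 else 0.
have be : bounded_measurable e.
  split; first exact: measurable_fun_ifT.
  by exists 1 => w; rewrite /e; case: ifP; rewrite ?normr1 ?normr0.
pose s w := sg w * e w.
have bs : bounded_measurable s.
  split; first by apply: measurable_funM => //; case: be.
  exists 1 => w; rewrite normrM sg_norm mul1r /e.
  by case: ifP; rewrite ?normr1 ?normr0.
have e0 w : 0 <= e w by rewrite /e; case: ifP.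
have normE : `|weighted s| = \int[mu]_w (eta w * e w).
  rewrite -[LHS]powRr1// -[X in _ `^ X]r1 -[LHS]/(fine (`|weighted s| `^ r)%:E).
  rewrite norm_weighted//; congr fine; apply: eq_integral => w _.
  rewrite r1 powRr1// !normrM sg_norm mul1r !ger0_norm//.
  exact: ltW.
have phiE : phi (weighted s) = \int[mu]_w (`|rho w| * e w).
  have [_ ->] := density_agrees_bounded bs.
  by apply: eq_Rintegral => w _; rewrite mulrA rho_sg.
have int_rho : mu.-integrable setT (EFin \o (fun w => `|rho w| * e w)).
  have := density_integrable bs.
  by under eq_fun do rewrite /= mulrA rho_sg.
have int_eta : mu.-integrable setT (EFin \o (fun w => eta w * e w)).
  apply: (le_integrable measurableT _ _ ieta) => /=.
    by apply/measurable_EFinP; apply: measurable_funM => //; case: be.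
  move=> w _; rewrite lee_fin normrM ler_piMr// ger0_norm//.
  by rewrite /e; case: ifP.
pose f w := `|rho w| * e w - M * (eta w * e w).
have int_f : mu.-integrable setT (EFin \o f).
  have := integrableB measurableT int_rho (integrableZl measurableT M int_eta).
  by [].
have rhoE w : `|rho w| = `|y w| * eta w.
  by rewrite -riesz_funE normrM (ger0_norm (ltW (eta_gt0 w))).
have f_pos w : E w -> 0 < f w.
  move=> Ew; rewrite /f /e Ew !mulr1 rhoE -mulrBl mulr_gt0// subr_gt0.
  exact: Ew.
have f0 w : 0 <= f w.
  case: (boolP (E w)) => Ew; first exact/ltW/f_pos.
  by rewrite /f /e (negbTE Ew) !mulr0 subr0.
have If : \int[mu]_w f w <= 0.
  rewrite /f RintegralB//; last exact: (integrableZl measurableT M int_eta).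
  rewrite RintegralZl// -phiE -normE subr_le0.
  by rewrite (le_trans (ler_norm _)).
apply: filterS (ae_eq0_of_Rintegral_le0 int_f f0 If) => w fw.
by rewrite leNgt; apply/negP => /f_pos; rewrite fw ltxx.
Qed.

(** With y = rho / eta and test functions x_n = sg(rho) |y| ^ (q - 1) cut off
    where |y| ^ (q - 1) > n eta, both [phi x_n] and the r-th power of the norm of
    x_n are the integral of |y| ^ q over the remaining set.  Boundedness of
    [phi] then bounds these integrals uniformly in n, and monotone convergence
    bounds the integral of |y| ^ q. *)
Lemma riesz_fun_Lfun (q : R) : 1 < r -> r^-1 + q^-1 = 1 ->
  riesz_fun \in Lfun mu q%:E.
Proof.
move=> r1 rq.
have r0 : 0 < r by lra.
have q0 : q != 0.
  by apply/eqP => q0; move: rq; rewrite q0 invr0 addr0 => /eqP; rewrite invr_eq1 gt_eqF.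
have rqE : (q - 1) * r = q.
  have rn : r != 0 by rewrite gt_eqF.
  have : (r^-1 + q^-1) * (r * q) = r * q by rewrite rq mul1r.
  by rewrite mulrDl mulrA mulVf// mul1r [r * q]mulrC mulrA mulVf// mul1r; lra.
have q1 : 1 < q.
  have : (q - 1) * (r - 1) = 1 by move: rqE; lra.
  by move=> h; rewrite ltNge; apply/negP => q1; move: h; nra.
have M0 : 0 <= Num.max M 0 by rewrite le_max lexx orbT.
set M' := Num.max M 0 in M0.
pose B := (M' `^ (r - 1)^-1) `^ r.
pose E n w := `|y w| `^ (q - 1) <= n%:R * eta w.
have mpow (a : R) : measurable_fun setT (fun w => `|y w| `^ a).
  by apply: (measurableT_comp (measurable_powR _)); exact: measurableT_comp.
have mE n : measurable_fun setT (E n).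
  by apply: measurable_fun_ler => //; exact: measurable_funM.
pose t n w := if E n w then `|y w| `^ (q - 1) / eta w else 0.
have t0 n w : 0 <= t n w.
  by rewrite /t; case: ifP => // _; rewrite divr_ge0 ?powR_ge0// ltW.
have mt n : measurable_fun setT (t n).
  apply: measurable_fun_ifT => //; apply: measurable_funM => //.
  exact: measurable_funV_gt0.
have tn n w : t n w <= n%:R.
  by rewrite /t; case: ifPn => // Enw; rewrite ler_pdivrMr.
pose s n w := sg w * t n w.
have bs n : bounded_measurable (s n).
  split; first exact: measurable_funM.
  by exists n%:R => w; rewrite normrM sg_norm mul1r ger0_norm.
pose F n w := if E n w then `|y w| `^ q else 0.
have F0 n w : 0 <= F n w by rewrite /F; case: ifP => // _; exact: powR_ge0.
have mF n : measurable_fun setT (F n) by exact: measurable_fun_ifT.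
have normE n : (`|weighted (s n)| `^ r)%:E = (\int[mu]_w (F n w)%:E)%E.
  rewrite norm_weighted//; apply: eq_integral => w _; congr EFin.
  rewrite /s /t /F normrM ger0_norm ?(ltW (eta_gt0 w))// normrM sg_norm mul1r.
  case: ifPn => Enw; last by rewrite normr0 mulr0 powR0// gt_eqF.
  rewrite ger0_norm; last by rewrite divr_ge0 ?powR_ge0// ltW.
  by rewrite mulrC divfK ?gt_eqF// -powRrM rqE.
have phiE n : phi (weighted (s n)) = `|weighted (s n)| `^ r.
  have [_ ->] := density_agrees_bounded (bs n).
  rewrite -[RHS]/(fine (`|weighted (s n)| `^ r)%:E) normE.
  congr fine; apply: eq_integral => w _; congr EFin.
  rewrite /s mulrA rho_sg /t /F; case: ifPn => Enw; last by rewrite mulr0.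
  rewrite -riesz_funE normrM (ger0_norm (ltW (eta_gt0 w))) -/y.
  rewrite mulrACA [eta w * _]mulrC mulVf ?gt_eqF// mulr1.
  by rewrite mulr_powRB1//; lra.
(* t ^ r <= M' t forces t <= M' ^ (1 / (r - 1)) *)
have normB n : `|weighted (s n)| `^ r <= B.
  set z := weighted (s n).
  have [->|z0] := eqVneq `|z| 0; first by rewrite powR0 ?gt_eqF// powR_ge0.
  have zgt : 0 < `|z| by rewrite lt_neqAle eq_sym z0 normr_ge0.
  have h : `|z| `^ r <= M' * `|z|.
    rewrite -phiE (le_trans (ler_norm _))// (le_trans (phi_bounded _))//.
    by rewrite ler_wpM2r// le_max lexx.
  have {}h : `|z| `^ (r - 1) <= M'.
    by rewrite -(ler_pM2l zgt) mulr_powRB1// mulrC.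
  apply: ge0_ler_powR; rewrite ?nnegrE ?powR_ge0//; first exact: ltW.
  have -> : `|z| = (`|z| `^ (r - 1)) `^ (r - 1)^-1.
    by rewrite -powRrM mulfV ?powRr1// gt_eqF// subr_gt0.
  by apply: ge0_ler_powR; rewrite ?nnegrE ?powR_ge0 ?invr_ge0//; lra.
apply/Lfun_powR_lty; first exact: ltW.
split=> //; apply: (@le_lt_trans _ _ B%:E); last exact: ltry.
have cF : (\int[mu]_w (F n w)%:E @[n --> \oo] --> \int[mu]_w (`|y w| `^ q)%:E)%E.
  have limF w : limn (fun n => (F n w)%:E) = (`|y w| `^ q)%:E.
    apply: cvg_lim => //; apply: cvg_near_cst; near=> n.
    suff Enw : E n w by rewrite /F Enw.
    by rewrite /E -ler_pdivrMr//; near: n; exact: nbhs_infty_ger.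
  have -> : (\int[mu]_w (`|y w| `^ q)%:E = \int[mu]_w limn (fun n => (F n w)%:E))%E.
    by apply: eq_integral => w _; rewrite limF.
  apply: (@cvg_monotone_convergence _ _ _ mu setT measurableT (fun n w => (F n w)%:E)).
  - by move=> n; exact/measurable_EFinP.
  - by move=> n w _; rewrite lee_fin.
  - move=> w _ n m nm; rewrite lee_fin /F; case: ifPn => Enw; last by case: ifP.
    suff Emw : E m w by rewrite Emw.
    by rewrite /E (le_trans Enw)// ler_wpM2r ?ler_nat// ltW.
have <- : limn (fun n => \int[mu]_w (F n w)%:E)%E = (\int[mu]_w (`|y w| `^ q)%:E)%E.
  exact: cvg_lim.
apply: lime_le; first by apply/cvg_ex; eexists; exact: cF.
by apply: nearW => n; rewrite -normE lee_fin.
Unshelve. all: by end_near. Qed.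
(** An element [x] of L^p cut off where |x| > n eta is [eta] times a bounded
    function, and these truncations are dominated by [x]. *)
Lemma riesz_fun_representsE (q : \bar R) (q1 : (1 <= q)%E) :
  ((r%:E)^-1 + q^-1 = 1)%E -> riesz_fun \in Lfun mu q ->
  represents (to_Lspace mu q1 riesz_fun) phi.
Proof.
move=> rq Ly x; set Y := to_Lspace mu q1 riesz_fun.
have mx := Lspace_measurable x.
pose E n w := `|x w| <= n%:R * eta w.
have mE n : measurable_fun setT (E n).
  by apply: measurable_fun_ler; [exact: measurableT_comp|exact: measurable_funM].
pose s n w := if E n w then x w / eta w else 0.
have bs n : bounded_measurable (s n).
  split.
    apply: measurable_fun_ifT => //; apply: measurable_funM => //.
    exact: measurable_funV_gt0.
  exists n%:R => w; rewrite /s; case: ifPn => Enw; last by rewrite normr0.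
  by rewrite normrM normfV (gtr0_norm (eta_gt0 w)) ler_pdivrMr.
have sE n w : eta w * s n w = if E n w then x w else 0.
  rewrite /s; case: ifP => _; last by rewrite mulr0.
  by rewrite mulrC divfK// gt_eqF.
have dom n : \forall w \ae mu, `|weighted (s n) w| <= `|x w|.
  apply: filterS (weightedE (bs n)) => w ->; rewrite sE.
  by case: ifP => _//; rewrite normr0.
have cvgx : \forall w \ae mu, weighted (s n) w @[n --> \oo] --> x w.
  apply: filterS (ae_foralln (fun n => weightedE (bs n))) => w wE.
  under eq_fun do rewrite wE sE.
  apply: cvg_near_cst; near=> n.
  suff -> : E n w by [].
  by rewrite /E -ler_pdivrMr//; near: n; exact: nbhs_infty_ger.
have cphi : phi (weighted (s n)) @[n --> \oo] --> phi x.
  apply: (cvg_comp (fun n => weighted (s n)) phi _ (@phi_continuous x)).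
  exact: Lspace_dominated_cvg dom cvgx.
have cpair := @Lpair_dominated_cvg _ _ _ mu _ q p1 q1 rq Y _ _ _ dom cvgx.
suff phiE n : phi (weighted (s n)) = Lpair Y (weighted (s n)).
  by move: cphi; under eq_fun do rewrite phiE; move=> cphi; exact: cvg_unique cphi cpair.
have [_ ->] := density_agrees_bounded (bs n); apply/esym/Lpair_eq.
  by apply: measurable_funM => //; case: (bs n).
apply: filterS2 (to_LspaceE q1 Ly) (weightedE (bs n)) => w -> ->.
by rewrite mulrA riesz_funE.
Unshelve. all: by end_near. Qed.

End density.
End riesz_representation.

Theorem Lspace_riesz d (T : measurableType d) (R : realType)
    (mu : {sigma_finite_measure set T -> \bar R}) (p q : \bar R)
    (p1 : (1 <= p)%E) (q1 : (1 <= q)%E) (phi : LspaceType mu p1 -> R) :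
  (p^-1 + q^-1 = 1)%E -> p != +oo%E -> scalar phi -> continuous phi ->
  exists y : LspaceType mu q1, represents y phi.
Proof.
case: p p1 phi => [r|//|//] p1 phi pq _ lphi cphi.
have r1 : 1 <= r by [].
have [M phi_bounded] : exists M, forall x, `|phi x| <= M * `|x|.
  pose F : {linear LspaceType mu p1 -> R^o} :=
    HB.pack phi (GRing.isLinear.Build R _ R^o _ phi lphi).
  have /linear_bounded_continuous/linear_boundedP : continuous F by exact: cphi.
  by move=> /pinfty_ex_gt0[M _ MP]; exists M.
have [eta [meta eta01 ieta]] := positive_integrable_weight mu.
have [rho [irho rhoE]] := weighted_density lphi cphi meta eta01 ieta.
exists (to_Lspace mu q1 (riesz_fun eta rho)).
apply: (riesz_fun_representsE lphi cphi meta eta01 ieta irho rhoE) => //.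
have r_gt0 : 0 < r by rewrite (lt_le_trans _ r1).
case: q q1 pq => [s|_|//] sq; last first.
  move: sq; rewrite inver gt_eqF// invey adde0 => -[/eqP]; rewrite invr_eq1 => /eqP r1E.
  exact: (riesz_fun_Lfun_oo lphi cphi phi_bounded).
move=> rs; have s1 : 1 <= s by [].
have s_gt0 : 0 < s by rewrite (lt_le_trans _ s1).
move: rs; rewrite !inver !gt_eqF// -EFinD => -[rs].
apply: (riesz_fun_Lfun lphi cphi phi_bounded) => //.
have : 0 < s^-1 by rewrite invr_gt0.
by move: rs; rewrite -(invf_lt1 r_gt0); lra.
Qed.

(** * Sign of a functional that is nonnegative on the shrunken cone *)

Lemma diff_ge0_right_local_min (R : realType) (V : normedModType R) (f : V -> R)
    (x v : V) : differentiable f x ->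
  (\forall t \near (0 : R)^'+, f x <= f (x + t *: v)) -> 0 <= 'd f x v.
Proof.
move=> df fmin; rewrite -deriveE//.
have dv : derivable f x v by exact: diff_derivable.
rewrite /derive -(cvg_lim _ (cvg_dnbhs_at_right dv))//.
apply: limr_ge; first by apply/cvg_ex; eexists; exact: (cvg_dnbhs_at_right dv).
near=> t; have t0 : 0 < t by near: t; exact: nbhs_right_gt.
apply: mulr_ge0; rewrite ?invr_ge0 ?(ltW t0)//= subr_ge0 addrC.
by near: t.
Unshelve. all: by end_near. Qed.

Section box_multiplier.
Context d (T : measurableType d) (R : realType).
Variable mu : {sigma_finite_measure set T -> \bar R}.
Variables (p q : \bar R) (p1 : (1 <= p)%E) (q1 : (1 <= q)%E).
Hypothesis pq : (p^-1 + q^-1 = 1)%E.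
Variables (xa xb : T -> \bar R).
Hypotheses (mxa : measurable_fun setT xa) (mxb : measurable_fun setT xb).

Local Notation Lp := (LspaceType mu p1).
Local Notation K := (box xa xb : set Lp).

Lemma le_convex_combination (l u : \bar R) (t y z : R) : 0 <= t -> t <= 1 ->
  (l <= y%:E <= u)%E -> (l <= z%:E <= u)%E ->
  (l <= ((1 - t) * y + t * z)%:E <= u)%E.
Proof.
move=> t0 t1 /andP[ly yu] /andP[lz zu]; apply/andP; split.
  case: l ly lz => [l| |]; rewrite ?leNye// !lee_fin => ly lz; nra.
by case: u yu zu => [u| |]; rewrite ?leey// !lee_fin => yu zu; nra.
Qed.

Lemma box_convex (t : R) (u v : Lp) : 0 <= t -> t <= 1 -> K u -> K v ->
  K ((1 - t) *: u + t *: v).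
Proof.
move=> t0 t1 Ku Kv; apply: filterS3 (filterI Ku Kv)
  (LspaceDE ((1 - t) *: u) (t *: v)) (filterI (LspaceZE (1 - t) u) (LspaceZE t v)).
by move=> w [uw vw] -> [-> ->]; exact: le_convex_combination.
Qed.

Variables (x z : Lp) (y : LspaceType mu q1).
Hypotheses (Kx : K x) (Kz : strict_box xa xb z).
Hypothesis y_ge0 : forall v, two_point_cone K x z v -> 0 <= Lpair y v.

Lemma strict_boxW : K z.
Proof. by apply: filterS Kz => w /andP[/ltW -> /ltW ->]. Qed.

(** The functions [v n] approximate [k - x] by elements of the cone: steps of
    length 1 / (n + 1) stay in the box, from [x] by convexity and from [z] by
    the choice of the set [E n].  Strictness of the bounds at [z] makes [v n w] eventually
    equal to [k w - x w] at almost every point. *)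
Lemma box_variational (k : Lp) : K k -> 0 <= Lpair y (k - x).
Proof.
move=> Kk.
pose m n w := z w - n.+1%:R^-1 * (k w - x w).
pose E n w := (xa w <= (m n w)%:E)%E && ((m n w)%:E <= xb w)%E.
have mm n : measurable_fun setT (m n).
  apply: measurable_funB; first exact: Lspace_measurable.
  by apply: measurable_funM => //; apply: measurable_funB; exact: Lspace_measurable.
have mE n : measurable_fun setT (E n).
  by apply: measurable_and; apply: measurable_fun_lee => //; exact/measurable_EFinP.
pose v n w := if E n w then k w - x w else z w - x w.
have mv n : measurable_fun setT (v n).
  by apply: measurable_fun_ifT => //; apply: measurable_funB; exact: Lspace_measurable.
pose G w := `|k w - x w| + `|z w - x w|.
have mG : measurable_fun setT G.
  apply: measurable_funD; apply: measurableT_comp => //;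
    by apply: measurable_funB; exact: Lspace_measurable.
have LB (a b : Lp) : (fun w => `|a w - b w|) \in Lfun mu p.
  apply: (ae_le_Lfun p1 _ (Lspace_Lfun (a - b))).
    by apply: measurableT_comp => //; apply: measurable_funB; exact: Lspace_measurable.
  by apply: filterS (LspaceBE a b) => w ->; rewrite normr_id.
have LG : G \in Lfun mu p.
  have -> : G = (fun w => 1 * `|k w - x w| + `|z w - x w|).
    by apply/funext => w; rewrite mul1r.
  exact: Lfun_lc.
have vG n w : `|v n w| <= `|G w|.
  rewrite [leRHS]ger0_norm ?addr_ge0// /v /G.
  by case: ifP => _; rewrite ?lerDl ?lerDr.
have Lv n : v n \in Lfun mu p by apply: (ae_le_Lfun p1 _ LG) => //; exact: aeW.
pose V n : Lp := to_Lspace mu p1 (v n).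
have VE n : \forall w \ae mu, V n w = v n w by exact: to_LspaceE.
have cV : Lpair y (V n) @[n --> \oo] --> Lpair y (k - x).
  apply: (@Lpair_dominated_cvg _ _ _ mu _ _ p1 q1 pq y V (k - x) (to_Lspace mu p1 G)).
    by move=> n; apply: filterS2 (VE n) (to_LspaceE p1 LG) => w -> ->.
  have := ae_foralln VE; apply: filterS3 Kz (LspaceBE k x) => w /andP[zl zu] -> Vw.
  under eq_fun do rewrite Vw.
  apply: cvg_near_cst.
  have cm : m n w @[n --> \oo] --> z w.
    rewrite -[X in _ --> X]subr0; apply: cvgB; first exact: cvg_cst.
    rewrite -(mul0r (k w - x w)); apply: cvgMl; exact: cvg_harmonic.
  have al : \forall n \near \oo, (xa w <= (m n w)%:E)%E.
    case: (xa w) zl => [l| |] //; rewrite ?lte_fin => zl.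
      near=> n; rewrite lee_fin ltW//; near: n.
      by apply: (cvgr_gt (z w)).
    by apply: nearW => n; rewrite leNye.
  have au : \forall n \near \oo, ((m n w)%:E <= xb w)%E.
    case: (xb w) zu => [u| |] //; rewrite ?lte_fin => zu.
      near=> n; rewrite lee_fin ltW//; near: n.
      by apply: (cvgr_lt (z w)).
    by apply: nearW => n; rewrite leey.
  near=> n; suff Enw : E n w by rewrite /v Enw.
  by apply/andP; split; near: n.
rewrite -(cvg_lim _ cV)//; apply: limr_ge; first by apply/cvg_ex; eexists; exact: cV.
apply: nearW => n; apply: y_ge0.
have n1 : n.+1%:R^-1 <= 1 :> R by rewrite invf_le1// ler1n.
have n0 : 0 <= n.+1%:R^-1 :> R by [].
exists (n.+1%:R^-1); first by rewrite invr_gt0.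
have KzW := strict_boxW.
split.
  apply: filterS3 (filterI Kx (filterI KzW Kk)) (LspaceDE x (n.+1%:R^-1 *: V n))
    (filterI (LspaceZE n.+1%:R^-1 (V n)) (VE n)) => w [xw [zw kw]] -> [-> ->].
  rewrite /v; case: ifP => _.
    have -> : x w + n.+1%:R^-1 * (k w - x w) = (1 - n.+1%:R^-1) * x w + n.+1%:R^-1 * k w by ring.
    exact: le_convex_combination.
  have -> : x w + n.+1%:R^-1 * (z w - x w) = (1 - n.+1%:R^-1) * x w + n.+1%:R^-1 * z w by ring.
  exact: le_convex_combination.
apply: filterS3 (filterI Kx KzW) (LspaceBE z (n.+1%:R^-1 *: V n))
  (filterI (LspaceZE n.+1%:R^-1 (V n)) (VE n)) => w [xw zw] -> [-> ->].
rewrite /v; case: ifP => [Enw|_]; first exact: Enw.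
have -> : z w - n.+1%:R^-1 * (z w - x w) = (1 - n.+1%:R^-1) * z w + n.+1%:R^-1 * x w by ring.
exact: le_convex_combination.
Unshelve. all: by end_near. Qed.

(** Localization: the inequality [box_variational] is applied to [s] restricted
    to the set where the integrand is negative. *)
Lemma box_variational_ae (eta s : T -> R) : eta \in Lfun mu p ->
  measurable_fun setT s ->
  (\forall w \ae mu, `|s w| <= `|eta w|) ->
  (\forall w \ae mu, (xa w <= (x w + s w)%:E <= xb w)%E) ->
  \forall w \ae mu, 0 <= y w * s w.
Proof.
move=> Leta ms s_eta Ks.
have my := Lspace_measurable y.
pose E w := y w * s w < 0.
have mE : measurable_fun setT E.
  by apply: measurable_fun_ltr => //; exact: measurable_funM.
pose u w := if E w then s w else 0.
have mus : measurable_fun setT u by exact: measurable_fun_ifT.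
have Lu : u \in Lfun mu p.
  apply: (ae_le_Lfun p1 mus Leta); apply: filterS s_eta => w sw.
  by rewrite /u; case: ifP; rewrite ?normr0.
pose U : Lp := to_Lspace mu p1 u.
have UE : \forall w \ae mu, U w = u w by exact: to_LspaceE.
have KU : K (x + U).
  apply: filterS3 (filterI Kx Ks) (LspaceDE x U) UE => w [xw sw] -> ->.
  by rewrite /u; case: ifP => _//; rewrite addr0.
have := box_variational KU; rewrite addrAC subrr add0r.
rewrite (@Lpair_eq _ _ _ mu p q p1 q1 y U (fun w => y w * u w)); last 2 first.
- exact: measurable_funM.
- by apply: filterS UE => w ->.
move=> I0.
pose f w := - 1 * (y w * u w).
have iu : mu.-integrable setT (EFin \o (fun w => y w * u w)).
  exact: (Lfun_mul_integrable p1 q1 pq (Lspace_Lfun y) Lu).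
have intf : mu.-integrable setT (EFin \o f).
  exact: (integrableZl measurableT (- 1) iu).
have f0 w : 0 <= f w.
  by rewrite /f /u mulN1r oppr_ge0; case: ifP => [/ltW//|_]; rewrite mulr0.
have If : \int[mu]_w f w <= 0 by rewrite RintegralZl// mulN1r oppr_le0.
apply: filterS (ae_eq0_of_Rintegral_le0 intf f0 If) => w fw.
rewrite leNgt; apply/negP => ysw; move: fw; rewrite /f /u /E ysw => /eqP.
by rewrite mulN1r oppr_eq0 lt_eqF.
Qed.

(** The perturbation [s] lifts [x] by [eta], capped at the upper bound; it is
    positive where there is room below that bound. *)
Lemma box_sign_upper : \forall w \ae mu, ((x w)%:E < xb w)%E -> 0 <= y w.
Proof.
have [eta [meta eta01 ieta]] := positive_integrable_weight mu.
have Leta := weight_Lfun p1 meta eta01 ieta.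
have eta0 w : 0 < eta w by case/andP: (eta01 w).
pose s w := fine (mine (xb w) (x w + eta w)%:E) - x w.
have mx := Lspace_measurable x.
have ms : measurable_fun setT s.
  apply: measurable_funB => //; apply: measurableT_comp => //.
  by apply: measurable_mine => //; apply/measurable_EFinP; exact: measurable_funD.
have sP w : ((x w)%:E <= xb w)%E ->
    [/\ 0 <= s w, s w <= eta w, ((x w + s w)%:E <= xb w)%E &
        ((x w)%:E < xb w)%E -> 0 < s w].
  rewrite /s; have := eta0 w; case: (xb w) => [u| |] e0 xu.
  - rewrite -EFin_min /= !lte_fin !lee_fin; move: xu; rewrite lee_fin => xu.
    by case: (leP u (x w + eta w)) => h; split=> // *; lra.
  - by rewrite min_r ?leey//=; split=> // *; lra.
  - by move: xu; rewrite leNgt ltNyr.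
have : \forall w \ae mu, 0 <= y w * s w.
  apply: (box_variational_ae Leta ms).
    apply: filterS Kx => w /andP[_ /sP[s0 se _ _]].
    by rewrite !ger0_norm// ltW.
  apply: filterS Kx => w /andP[xl /sP[s0 _ -> _]]; rewrite andbT.
  by rewrite (le_trans xl)// lee_fin lerDl.
apply: filterS2 Kx => w /andP[_ /sP[_ _ _ s0]] ys /s0 sw.
by rewrite -(pmulr_lge0 _ sw).
Qed.

(** As for the upper bound, with [x] lowered by [eta], but not below [xa]. *)
Lemma box_sign_lower : \forall w \ae mu, (xa w < (x w)%:E)%E -> y w <= 0.
Proof.
have [eta [meta eta01 ieta]] := positive_integrable_weight mu.
have Leta := weight_Lfun p1 meta eta01 ieta.
have eta0 w : 0 < eta w by case/andP: (eta01 w).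
pose s w := fine (maxe (xa w) (x w - eta w)%:E) - x w.
have mx := Lspace_measurable x.
have ms : measurable_fun setT s.
  apply: measurable_funB => //; apply: measurableT_comp => //.
  by apply: measurable_maxe => //; apply/measurable_EFinP; exact: measurable_funB.
have sP w : (xa w <= (x w)%:E)%E ->
    [/\ s w <= 0, - s w <= eta w, (xa w <= (x w + s w)%:E)%E &
        (xa w < (x w)%:E)%E -> s w < 0].
  rewrite /s; have := eta0 w; case: (xa w) => [u| |] e0 xu.
  - rewrite -EFin_max /= !lte_fin !lee_fin; move: xu; rewrite lee_fin => xu.
    by case: (leP u (x w - eta w)) => h; split=> // *; lra.
  - by move: xu; rewrite leNgt ltry.
  - by rewrite max_r ?leNye//=; split=> // *; lra.
have : \forall w \ae mu, 0 <= y w * s w.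
  apply: (box_variational_ae Leta ms).
    apply: filterS Kx => w /andP[/sP[s0 se _ _] _].
    by rewrite ler0_norm// ger0_norm// ltW.
  apply: filterS Kx => w /andP[/sP[s0 _ -> _] xu] /=.
  by rewrite (le_trans _ xu)// lee_fin gerDl.
apply: filterS2 Kx => w /andP[/sP[_ _ _ s0] _] ys /s0 sw.
by rewrite -(nmulr_lge0 _ sw).
Qed.

End box_multiplier.

(** * The multiplier rule *)

Section multiplier_rule.
Context d (T : measurableType d) (R : realType).
Variable mu : {sigma_finite_measure set T -> \bar R}.
Variables (p q : \bar R) (p1 : (1 <= p)%E) (q1 : (1 <= q)%E).
Hypothesis pq : (p^-1 + q^-1 = 1)%E.
Variables (xa xb : T -> \bar R) (n m : nat).
Variables (g : 'I_n -> LspaceType mu q1) (a : 'I_n -> R).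
Variables (h : 'I_m -> LspaceType mu q1) (b : 'I_m -> R).
Variable f : LspaceType mu p1 -> R.

Local Notation K := (box xa xb : set (LspaceType mu p1)).

(** Along [v] the box constraint holds for short steps by convexity, the active
    inequalities because [v] does not increase them, and the inactive ones by
    their slack. *)
Lemma linearized_optimality (x z v : LspaceType mu p1) :
  differentiable f x -> (K `&` polyhedron g a h b) x -> K z ->
  (\forall u \near x, (K `&` polyhedron g a h b) u -> f x <= f u) ->
  two_point_cone K x z v ->
  (forall i, i \in active g a x -> Lpair (g i) v <= 0) ->
  (forall j, Lpair (h j) v = 0) -> 0 <= 'd f x v.
Proof.
move=> df [Kx [gx hx]] Kz fmin [c c0 Kc] gv hv.
apply: diff_ge0_right_local_min => //.
have cvg_line : (x + t *: v) @[t --> 0^'+] --> x.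
  apply: cvg_at_right_filter; rewrite -[X in _ --> X]addr0 -[X in _ + X](scale0r v).
  by apply: cvgD; [exact: cvg_cst|apply: cvgZr_tmp; exact: cvg_id].
have ga : \forall t \near 0^'+, forall i, Lpair (g i) (x + t *: v) <= a i.
  apply: filter_forall => i.
  have gE t : Lpair (g i) (x + t *: v) = Lpair (g i) x + t * Lpair (g i) v.
    by rewrite (scalarD _ _ (@Lpair_scalar _ _ _ mu p q p1 q1 pq (g i)))
      (scalarZ _ _ (@Lpair_scalar _ _ _ mu p q p1 q1 pq (g i))).
  have [gvi|gvi] := leP (Lpair (g i) v) 0.
    near=> t; have t0 : 0 < t by near: t; exact: nbhs_right_gt.
    by rewrite gE; have := gx i; nra.
  have gi : 0 < a i - Lpair (g i) x.
    rewrite subr_gt0 lt_neqAle gx andbT; apply/negP => giE.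
    by have := gv i; rewrite finset.inE => /(_ giE); rewrite leNgt gvi.
  near=> t; rewrite gE -lerBrDl -ler_pdivlMr//; near: t; apply: nbhs_right_le.
  exact: divr_gt0.
near=> t; have t0 : 0 < t by near: t; exact: nbhs_right_gt.
have tc : t <= c by near: t; exact: nbhs_right_le.
suff feas : (K `&` polyhedron g a h b) (x + t *: v).
  by move: feas; near: t; exact: cvg_line fmin.
split.
  by have [] := @two_point_cone_shrink _ _ K x z (@box_convex _ _ _ mu p p1 xa xb)
    Kx Kz v c t (ltW t0) tc Kc.
split; first by near: t.
move=> j; rewrite (scalarD _ _ (@Lpair_scalar _ _ _ mu p q p1 q1 pq (h j))).
by rewrite (scalarZ _ _ (@Lpair_scalar _ _ _ mu p q p1 q1 pq (h j))) hx hv mulr0 addr0.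
Unshelve. all: by end_near. Qed.

Lemma Lpair_sum (I : finType) (P : pred I) (c : I -> R)
    (l : I -> LspaceType mu q1) (v : LspaceType mu p1) :
  Lpair (\sum_(i | P i) c i *: l i) v = \sum_(i | P i) c i * Lpair (l i) v.
Proof.
have ls := @Lpair_scalarl _ _ _ mu p q p1 q1 pq v.
elim/big_ind2 : _ => [|y1 s1 y2 s2 <- <-|i _]; first exact: scalar0 ls.
  exact: scalarD ls.
exact: scalarZ ls.
Qed.

End multiplier_rule.

Lemma Lspace_maxr0 d (T : measurableType d) (R : realType)
    (mu : {measure set T -> \bar R}) (q : \bar R) (q1 : (1 <= q)%E)
    (y : LspaceType mu q1) :
  exists y' : LspaceType mu q1, \forall w \ae mu, y' w = Num.max (y w) 0.
Proof.
exists (to_Lspace mu q1 (fun w => Num.max (y w) 0)); apply: to_LspaceE.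
apply: (ae_le_Lfun q1 _ (Lspace_Lfun y)).
  by apply: measurable_maxr => //; exact: Lspace_measurable.
by apply: aeW => w; case: (leP (y w) 0); rewrite ?normr0.
Qed.

Theorem theorem3p3 (d : measure_display) (T : measurableType d) (R : realType)
  (mu : {sigma_finite_measure set T -> \bar R})
  (p q : \bar R) (p1 : (1 <= p)%E) (q1 : (1 <= q)%E)
  (pq : (p^-1 + q^-1 = 1)%E)
  (xa xb : T -> \bar R)
  (mxa : measurable_fun setT xa) (mxb : measurable_fun setT xb)
  (n m : nat)
  (g : 'I_n -> LspaceType mu q1) (a : 'I_n -> R)
  (h : 'I_m -> LspaceType mu q1) (b : 'I_m -> R)
  (f : LspaceType mu p1 -> R)
  (f_diff : forall x, differentiable f x)
  (f_diff_oo : p = +oo%E ->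
     forall x, (box xa xb `&` polyhedron g a h b) x ->
       exists y : LspaceType mu q1, represents y ('d f x))
  (xbar : LspaceType mu p1)
  (xbar_feasible : (box xa xb `&` polyhedron g a h b) xbar)
  (xbar_locmin : \forall x \near xbar,
     (box xa xb `&` polyhedron g a h b) x -> f xbar <= f x)
  (slater : exists xhat : LspaceType mu p1,
     (strict_box xa xb `&` polyhedron g a h b) xhat) :
  exists (df zeta : LspaceType mu q1) (alpha : 'I_n -> R) (beta : 'I_m -> R),
    [/\ represents df ('d f xbar),
        (forall i, i \in active g a xbar -> 0 <= alpha i) /\
        df + zeta + \sum_(i in active g a xbar) alpha i *: g i
          + \sum_j beta j *: h j = 0,
        [/\ \forall w \ae mu, xa w = (xbar w)%:E -> ((xbar w)%:E < xb w)%E ->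
              zeta w <= 0,
            \forall w \ae mu, (xa w < (xbar w)%:E)%E -> ((xbar w)%:E < xb w)%E ->
              zeta w = 0
          & \forall w \ae mu, (xa w < (xbar w)%:E)%E -> (xbar w)%:E = xb w ->
              0 <= zeta w]
      & exists zeta_a zeta_b : LspaceType mu q1,
        [/\ \forall w \ae mu, zeta_b w = Num.max (zeta w) 0,
            \forall w \ae mu, zeta_a w = Num.max (- zeta w) 0,
            zeta = zeta_b - zeta_a,
            \forall w \ae mu, 0 <= zeta_a w /\ 0 <= zeta_b w
          & (\forall w \ae mu, (xa w < (xbar w)%:E)%E -> zeta_a w = 0) /\
            (\forall w \ae mu, ((xbar w)%:E < xb w)%E -> zeta_b w = 0)]].
Proof.
have [xhat [Kxhat [gxhat hxhat]]] := slater; have KxhatW := strict_boxW Kxhat.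
have [Kxbar [gxbar hxbar]] := xbar_feasible.
set A := active g a xbar.
have [df dfE] : exists df : LspaceType mu q1, represents df ('d f xbar).
  have [py|py] := eqVneq p +oo%E; first exact: f_diff_oo.
  apply: Lspace_riesz => //; first exact: linearP.
  exact: diff_continuous.
have lp (y : LspaceType mu q1) := @Lpair_scalar _ _ _ mu p q p1 q1 pq y.
have ls v := @Lpair_scalarl _ _ _ mu p q p1 q1 pq v.
have convK := @box_convex _ _ _ mu p p1 xa xb.
pose S := two_point_cone (box xa xb) xbar xhat.
have cS : is_convex_cone S by exact: two_point_cone_convex_cone.
have eS : core_point S (xhat - xbar) by exact: two_point_cone_core.
have Lpair_e (y : LspaceType mu q1) : Lpair y (xhat - xbar) = Lpair y xhat - Lpair y xbar.
  by rewrite -scaleN1r (scalarD _ _ (lp y)) (scalarZ _ _ (lp y)) mulN1r.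
have [|||alpha [beta [alpha0 multP]]] := @multiplier_le_eq R _ _ _
  (fun i => Lpair (g i)) (fun j => Lpair (h j)) A S (xhat - xbar) (Lpair df)
  (fun i => lp (g i)) (fun j => lp (h j)) (lp df) cS eS.
- move=> i; rewrite finset.inE Lpair_e => /eqP ->; rewrite subr_le0; exact: gxhat.
- by move=> j; rewrite Lpair_e hxhat hxbar subrr.
- move=> v Sv gv hv; rewrite -dfE.
  exact: (linearized_optimality pq (f_diff xbar) xbar_feasible KxhatW xbar_locmin Sv gv hv).
pose psi := df + \sum_(i in A) alpha i *: g i + \sum_j beta j *: h j.
have psi_ge0 v : S v -> 0 <= Lpair psi v.
  move=> /multP; rewrite /psi (scalarD _ _ (ls v)) (scalarD _ _ (ls v)).
  by rewrite !(Lpair_sum pq).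
have zeta_le0 : \forall w \ae mu, ((xbar w)%:E < xb w)%E -> (- psi) w <= 0.
  apply: filterS2 (box_sign_upper pq mxa mxb Kxbar Kxhat psi_ge0) (LspaceNE psi).
  by move=> w + -> xw => /(_ xw); rewrite oppr_le0.
have zeta_ge0 : \forall w \ae mu, (xa w < (xbar w)%:E)%E -> 0 <= (- psi) w.
  apply: filterS2 (box_sign_lower pq mxa mxb Kxbar Kxhat psi_ge0) (LspaceNE psi).
  by move=> w + -> xw => /(_ xw); rewrite oppr_ge0.
exists df, (- psi), alpha, beta; split=> //.
- split=> // ; rewrite /psi -/A.
  by rewrite -2!addrA [- _ + _]addrC addrA [X in X - _]addrA subrr.
- split.
  + by apply: filterS zeta_le0 => w zw _; exact: zw.
  + apply: filterS2 zeta_le0 zeta_ge0 => w z1 z2 xaw xbw.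
    by apply/eqP; rewrite eq_le z1// z2.
  + by apply: filterS zeta_ge0 => w zw xaw _; exact: zw.
have [zb zbE] := Lspace_maxr0 (- psi); have [za zaE'] := Lspace_maxr0 (- - psi).
have zaE : \forall w \ae mu, za w = Num.max (- (- psi) w) 0.
  by apply: filterS2 zaE' (LspaceNE (- psi)) => w -> ->.
exists za, zb; split=> //.
- apply: Lspace_eq; apply: filterS3 zaE zbE (LspaceBE zb za) => w aE bE ->.
  by rewrite aE bE; case: (leP ((- psi) w) 0); case: (leP (- (- psi) w) 0); lra.
- by apply: filterS2 zaE zbE => w -> ->; rewrite !le_max !lexx !orbT.
- split.
    apply: filterS2 zaE zeta_ge0 => w -> z0 /z0 zw.
    by rewrite max_r// oppr_le0.
  by apply: filterS2 zbE zeta_le0 => w -> z0 /z0 zw; rewrite max_r.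
Qed.
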